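(* For a prime $p$ and a vector $\vec a_p=(a_0,\ldots,a_{(p-1)/2})$, put $\ell_j=\ell(\sigma_p^j(\vec a_p))$ and define $b_j(n)$ by $f_{\sigma_p^j(\vec a_p)}=\sum_{n=0}^\infty b_j(n)q^n$. (1) Let $p\ge5$ be a prime and $\vec a_p=(6,1,0,\ldots,0,-4)$. Then $U_p(f_{\vec a_p})=p^2f_{\vec a_p}$ if and only if $b_j(ps)=0$ for $s<\ell_j$ and $2\le j\le\frac{p-1}2$. (2) Let $p\ge11$ be a prime and let $$\vec a_p\in\{(4,-2,0,\ldots,0,1,-2,1),\ (4,-2,0,\ldots,0,1,-1),\ (4,1,1,0,\ldots,0,-2,-2)\}.$$ Then $U_p(f_{\vec a_p})=pf_{\vec a_p}$ if and only if $b_j(ps)=0$ for $s<\ell_j$ and $2\le j\le\frac{p-1}2$. Here each displayed vector has length $(p+1)/2$, with as many zeros in place of $0,\ldots,0$ as needed.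
   Context: Let $q=e^{2\pi i\tau}$, $(a;q)_\infty=\prod_{n\ge 1}(1-aq^{n-1})$, $(a,b;q)_\infty=(a;q)_\infty(b;q)_\infty$, $\langle r\rangle=r-\lfloor r\rfloor$. For a prime $p\ge 5$, a positive even integer $a_0$ and integers $a_1,\ldots,a_{(p-1)/2}$, put $$\ell(a_0,\ldots,a_{(p-1)/2})=\frac{p}{24}\Bigl(a_0+2\sum_{i=1}^{(p-1)/2}a_i\Bigr)-\frac p2\sum_{i=1}^{(p-1)/2}\Bigl\langle\frac ip\Bigr\rangle\Bigl(1-\Bigl\langle\frac ip\Bigr\rangle\Bigr)a_i,\qquad f_{a_0,\ldots,a_{(p-1)/2}}(\tau)=q^{\ell}(q^p;q^p)_\infty^{a_0}\prod_{i=1}^{(p-1)/2}(q^i,q^{p-i};q^p)_\infty^{a_i}.$$ Permutation $\sigma_p$: let $\alpha$ be the least positive integer with $(\mathbb{Z}/p\mathbb{Z})^\times/\{\pm1\}=\langle\alpha\rangle$, and let $[m]\in\{1,\ldots,(p-1)/2\}$ be the representative of the class of $m$ in $(\mathbb{Z}/p\mathbb{Z})^\times/\{\pm1\}$. Then $\sigma_p=(1,[\alpha],\ldots,[\alpha^{(p-3)/2}])$ as a cycle in $S_{(p-1)/2}$, acting by $\sigma_p(a_0,a_1,\ldots,a_{(p-1)/2})=(a_0,a_{\sigma_p(1)},\ldots,a_{\sigma_p((p-1)/2)})$. $U_p$ acts on $f=\sum_{n\ge0}b(n)q^n$ by $U_p(f)=\sum_{n\ge0}b(pn)q^n$. *)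

(* Defs.v *)
From HB Require Import structures.
From mathcomp Require Import all_boot all_order all_algebra all_fingroup all_solvable.
From mathcomp Require Import zify.

Set Implicit Arguments.
Unset Strict Implicit.
Unset Printing Implicit Defensive.

Import Order.TTheory GRing.Theory Num.Theory.

Definition halfp (p : nat) : nat := p.-1./2.

Definition minus1 (p : nat) : {unit 'F_p} := FinRing.unit 'F_p (unitrN1 'F_p).

Definition generates_mod_pm1 (p a : nat) : bool :=
  [exists u : {unit 'F_p}, (val u == (a%:R)%R) &&
    ([set: {unit 'F_p}] / <[minus1 p]> == <[coset <[minus1 p]> u]>)%g].

Lemma ex_generator (p : nat) : exists a, (0 < a) && generates_mod_pm1 p a.
Proof.
have /cyclicP [u Gu] := field_unit_group_cyclic [set: {unit 'F_p}]%G.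
exists (val (val u)); apply/andP; split.
  have : val u != 0%R by rewrite -GRing.unitfE; exact: valP u.
  by rewrite lt0n; apply: contra => /eqP u0; apply/eqP/val_inj.
apply/existsP; exists u; rewrite natr_Zp eqxx /= Gu quotient_cycle //.
have abG : abelian [set: {unit 'F_p}] by apply: cyclic_abelian; apply/cyclicP; exists u.
exact: (subsetP (sub_abelian_norm abG (subsetT _)) _ (in_setT u)).
Qed.

Definition alpha (p : nat) : nat := ex_minn (ex_generator p).

(* [m]: the element of {1, ..., (p-1)/2} congruent to m or -m modulo p. *)
Definition repr_pm1 (p m : nat) : nat := minn (m %% p) (p - m %% p).

Lemma repr_pm1P (p m : nat) : prime p -> 2 < p -> ~~ (p %| m) ->
  (1 <= repr_pm1 p m <= halfp p) /\
  (repr_pm1 p m = m %[mod p] \/ p %| repr_pm1 p m + m).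
Proof.
move=> pp p2 pm; rewrite /repr_pm1 /halfp.
have r0 : 0 < m %% p by rewrite lt0n.
have rp : m %% p < p by rewrite ltn_mod; lia.
have op : odd p by have [] := even_prime pp; lia.
have [h|h] := leqP (m %% p) (p - m %% p).
  by split; [lia | left; rewrite modn_mod].
split; first lia.
right; rewrite {2}(divn_eq m p) addnCA subnK; last exact: ltnW.
by rewrite dvdn_add // dvdn_mull.
Qed.

(* The cycle (1, [alpha], ..., [alpha^((p-3)/2)]); [next] maps each entry to
   its cyclic successor and fixes every other natural number, 0 included. *)
Definition sigma (p : nat) : nat -> nat :=
  next [seq repr_pm1 p (alpha p ^ k) | k <- iota 0 (halfp p)].

Local Open Scope ring_scope.

(* A vector (a_0, ..., a_((p-1)/2)) is the sequence of its entries. *)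
Definition sigma_act (p : nat) (a : seq int) : seq int :=
  a`_0 :: [seq a`_(sigma p i) | i <- iota 1 (halfp p)].

Definition sigma_pow (p j : nat) (a : seq int) : seq int :=
  iter j (sigma_act p) a.

Definition fracpart (r : rat) : rat := r - (Num.floor r)%:~R.

Definition ell (p : nat) (a : seq int) : rat :=
  p%:R / 24 * (a`_0 + 2 * \sum_(1 <= i < (halfp p).+1) a`_i)%:~R
  - p%:R / 2 * \sum_(1 <= i < (halfp p).+1)
      fracpart (i%:R / p%:R) * (1 - fracpart (i%:R / p%:R)) * (a`_i)%:~R.

From mathcomp Require Import all_classical all_reals all_analysis.
From mathcomp Require Import complex.
Import numFieldNormedType.Exports.

Local Open Scope classical_set_scope.
Local Open Scope ring_scope.
Local Open Scope complex_scope.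

(* The ascription gives R[i] the topology of its modulus, through the
   instances that MathComp-Analysis puts on every numFieldType. *)
Definition Cplx (R : realType) : numClosedFieldType := R[i].

Definition upper_half_plane (R : realType) : set (Cplx R) :=
  [set tau : Cplx R | 0 < complex.Im tau].

Definition cexp (R : realType) (z : Cplx R) : Cplx R :=
  (expR (complex.Re z))%:C * (cos (complex.Im z) +i* sin (complex.Im z)).

(* q^r = e^(2 pi i r tau), for a rational exponent r *)
Definition qpow (R : realType) (tau : Cplx R) (r : rat) : Cplx R :=
  cexp ((0 +i* (2 * pi)) * ratr r * tau).

Definition qvar (R : realType) (tau : Cplx R) : Cplx R :=
  cexp ((0 +i* (2 * pi)) * tau).

Definition qpoch (R : realType) (a q : Cplx R) : Cplx R :=
  limn (fun N : nat => \prod_(1 <= n < N.+1) (1 - a * q ^+ n.-1)).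

Definition qpoch2 (R : realType) (a b q : Cplx R) : Cplx R :=
  qpoch a q * qpoch b q.

Definition feta (R : realType) (p : nat) (a : seq int) (tau : Cplx R) : Cplx R :=
  let q := qvar tau in
  qpow tau (ell p a) * qpoch (q ^+ p) (q ^+ p) ^ a`_0
  * \prod_(1 <= i < (halfp p).+1) qpoch2 (q ^+ i) (q ^+ (p - i)) (q ^+ p) ^ a`_i.

Definition is_qexpansion (R : realType) (f : Cplx R -> Cplx R)
    (b : nat -> Cplx R) : Prop :=
  forall tau, upper_half_plane tau ->
    series (fun n => b n * qvar tau ^+ n) @ \oo --> f tau.

(* The coefficients b(n) of f = sum_(n >= 0) b(n) q^n; they are unique when f
   has such an expansion, and are set to 0 when it has none. *)
Definition qcoef (R : realType) (f : Cplx R -> Cplx R) : nat -> Cplx R :=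
  xget (fun=> 0) [set b | is_qexpansion f b].

Definition Up (R : realType) (p : nat) (f : Cplx R -> Cplx R)
    (tau : Cplx R) : Cplx R :=
  limn (series (fun n => qcoef f (p * n) * qvar tau ^+ n)).

(* Main.v *)
Require Import Defs.
From mathcomp Require Import all_boot all_order all_algebra all_fingroup all_solvable.
From mathcomp Require Import all_classical all_reals all_analysis.
From mathcomp Require Import complex.
From mathcomp Require Import zify ring lra.

(** In each case both sides of the equivalence are true, because the eta quotients
    are Eisenstein series, given by Lambert series on which [U_p] acts visibly.

    Put [Q = q ^ p] and [theta x = (x, Q / x; Q)]. The exponents of each vector are
    governed by two residues [u >= v] in [1 .. (p - 1) / 2]: in weight 2,

      [f = q^v (Q; Q)^4 theta(q^(u+v)) theta(q^(u-v)) / (theta(q^u)^2 theta(q^v)^2)],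

    and in weight 3, where [u = v],

      [f = q^v (Q; Q)^6 theta(q^(2v)) / theta(q^v)^4].

    These are the product formulas for a difference of two values of Weierstrass'
    function, and for a value of its derivative, at [p]-division points. Hence [f]
    is the double series [sum d^(k-1) chi(m) q^(d m)] over [d, m >= 1], where [k] is
    the weight and [chi] depends on [m] modulo [p], is supported on the classes of
    [u], [-u], [v], [-v], and so vanishes on the multiples of [p] ([feta_lambert]).
    In a factorisation [p n = d m] with [chi(m)] nonzero, [p] divides [d]: the
    coefficient of index [p n] is [p^(k-1)] times the one of index [n]
    ([lambert_coefM]), which is the eigenvalue equation. The permutation [sigma_p] is
    multiplication by [alpha] on the classes modulo sign, so it turns the pair
    [(u, v)] into another pair, with the same type of exponents
    ([sigma_pow_exponents]), and [ell] is always the smaller element of the pair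
    ([ell_exponents]). As [f] has no term of degree less than [v], the coefficients
    [b_j(p s) = p^(k-1) b_j(s)] vanish for [s < ell_j].

    The two product formulas ([weight2_identity], [weight3_identity]) are proved
    without complex analysis. A partial fraction decomposition of a finite product
    ([finite_kronecker]) has as its limit Kronecker's formula

      [(Q; Q)^2 theta(a t) / (theta(a) theta(t)) = sum t^n / (1 - a Q^n)],

    the sum being over all integers [n] ([center_sum_cvg]). In the product of the
    series for [a] and for [1 / a], the terms of given nonzero degree in [t]
    telescope ([finite_square]): what is left is a Lambert series in [t] and a
    constant depending on [a] ([diagonal_sum_cvg]). The limit [t -> a] determines
    this constant, which gives the formula of weight 2, and the same limit after a
    division by [1 - t / a] gives the formula of weight 3 ([degeneration]). All the
    limits are instances of Tannery's theorem ([tannery]). *)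

Set Implicit Arguments.
Unset Strict Implicit.
Unset Printing Implicit Defensive.
Import Order.TTheory GRing.Theory Num.Theory.
Import numFieldNormedType.Exports.
Local Open Scope classical_set_scope.
Local Open Scope ring_scope.

(** * Moduli and limits of complex sequences *)

(** The norm of [R[i]] takes its values in [R[i]] itself; the estimates below are
    made in [R]. *)
Definition cmod (R : realType) (z : Cplx R) : R := ComplexField.Normc.normc z.

Section ComplexModulus.
Variable R : realType.
Local Notation C := (Cplx R).
Implicit Types x y z : C.

Lemma normE z : `|z| = (cmod z)%:C%C.
Proof. by []. Qed.

Lemma cmodM x y : cmod (x * y) = cmod x * cmod y.
Proof. exact: ComplexField.Normc.normcM. Qed.

Lemma cmod0 : cmod (0 : C) = 0.
Proof. exact: ComplexField.Normc.normc0. Qed.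

Lemma cmod1 : cmod (1 : C) = 1.
Proof. exact: ComplexField.Normc.normc1. Qed.

Lemma cmod_ge0 z : 0 <= cmod z.
Proof. by rewrite -lecR -normE normr_ge0. Qed.

Lemma cmod_eq0 z : (cmod z == 0) = (z == 0).
Proof. by rewrite -(inj_eq (@complexI R)) -normE normr_eq0. Qed.

Lemma cmod_gt0 z : (0 < cmod z) = (z != 0).
Proof. by rewrite lt_neqAle cmod_ge0 andbT eq_sym cmod_eq0. Qed.

Lemma cmodD x y : cmod (x + y) <= cmod x + cmod y.
Proof. by rewrite -lecR rmorphD /= -!normE ler_normD. Qed.

Lemma cmodN z : cmod (- z) = cmod z.
Proof. by apply: (@complexI R); rewrite -!normE normrN. Qed.

Lemma cmodB x y : cmod (x - y) <= cmod x + cmod y.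
Proof. by rewrite (le_trans (cmodD _ _)) // cmodN. Qed.

Lemma cmodV z : cmod z^-1 = (cmod z)^-1.
Proof. exact: ComplexField.Normc.normcV. Qed.

Lemma cmodX z n : cmod (z ^+ n) = cmod z ^+ n.
Proof. by elim: n => [|n IH]; rewrite ?expr0 ?cmod1 // !exprS cmodM IH. Qed.

Lemma cmod_nat n : cmod (n%:R : C) = n%:R.
Proof. by apply: (@complexI R); rewrite -normE normr_nat rmorph_nat. Qed.

Lemma cmod_real (r : R) : cmod (r%:C%C : C) = `|r|.
Proof.
by rewrite /cmod /ComplexField.Normc.normc /= expr0n addr0 sqrtr_sqr.
Qed.

Lemma cmod_sum (I : Type) (r : seq I) (P : pred I) (F : I -> C) :
  cmod (\sum_(i <- r | P i) F i) <= \sum_(i <- r | P i) cmod (F i).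
Proof.
elim/big_ind2 : _ => [|x a y b xa yb|//]; first by rewrite cmod0.
by rewrite (le_trans (cmodD _ _)) // lerD.
Qed.

Lemma cmod_prod (I : Type) (r : seq I) (P : pred I) (F : I -> C) :
  cmod (\prod_(i <- r | P i) F i) = \prod_(i <- r | P i) cmod (F i).
Proof. by elim/big_ind2 : _ => [|x a y b <- <-|//]; rewrite ?cmod1 ?cmodM. Qed.

Lemma le_Re_cmod z : `|complex.Re z| <= cmod z.
Proof. by rewrite -lecR -normE normc_ge_Re. Qed.

Lemma le_Im_cmod z : `|complex.Im z| <= cmod z.
Proof.
case: z => a b; rewrite /cmod /ComplexField.Normc.normc /=.
by rewrite -sqrtr_sqr ler_wsqrtr // lerDr sqr_ge0.
Qed.

Lemma cmod_le_ReIm z : cmod z <= `|complex.Re z| + `|complex.Im z|.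
Proof.
have -> : z = (complex.Re z)%:C%C + 'i%C * (complex.Im z)%:C%C by exact: complexE.
rewrite (le_trans (cmodD _ _)) // cmodM !cmod_real.
have -> : cmod ('i%C : C) = 1.
  by rewrite /cmod /ComplexField.Normc.normc /= expr0n add0r expr1n sqrtr1.
rewrite mul1r; case: z => a b /=.
by rewrite !(mul0r, mulr0, mul1r, addr0, add0r, subr0, oppr0).
Qed.

Lemma cvg_cmodP (u : nat -> C) (l : C) :
  u @ \oo --> l <-> (fun n => cmod (u n - l)) @ \oo --> (0 : R).
Proof.
split=> [/cvgrPdist_lt ul|/cvgrPdist_lt ul]; apply/cvgrPdist_lt => e e0.
- have /ul : 0 < (e%:C : C)%C by rewrite ltcR.
  apply: filterS => n; rewrite normE ltcR => h.
  by rewrite sub0r normrN ger0_norm ?cmod_ge0 // -cmodN opprB.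
- have eE : e = (complex.Re e)%:C%C by case: e e0 => a b; rewrite ltcE /= => /andP[/eqP -> _].
  have /ul : 0 < complex.Re e by move: e0; rewrite ltcE /= => /andP[].
  apply: filterS => n; rewrite sub0r normrN ger0_norm ?cmod_ge0 // => h.
  by rewrite eE normE ltcR -cmodN opprB.
Qed.

Lemma cvg_near_eq (u v : nat -> C) (l : C) :
  u @ \oo --> l -> (\forall n \near \oo, u n = v n) -> v @ \oo --> l.
Proof.
move=> ul uv; apply: cvg_trans ul; apply: near_eq_cvg.
by apply: filterS uv => n ->.
Qed.

Lemma cvg_ext (u v : nat -> C) (l : C) :
  u @ \oo --> l -> u =1 v -> v @ \oo --> l.
Proof. by move=> ul /funext <-. Qed.

Lemma cvg_eq_lim (u : nat -> C) (l m : C) :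
  u @ \oo --> l -> l = m -> u @ \oo --> m.
Proof. by move=> ul <-. Qed.

Lemma cvgs_cst (c : C) : (fun _ : nat => c) @ \oo --> c.
Proof. exact: cvg_cst. Qed.

Lemma cvg_uniq (u : nat -> C) (l m : C) :
  u @ \oo --> l -> u @ \oo --> m -> l = m.
Proof. by move=> h1 h2; exact: (cvg_unique _ h1 h2). Qed.

(** The usual limit rules, for functions written pointwise. *)
Section SequenceLimits.
Variables (u v : nat -> C) (l m : C).
Hypotheses (ul : u @ \oo --> l) (vm : v @ \oo --> m).

Lemma cvgsD : (fun n => u n + v n) @ \oo --> l + m.
Proof. exact: cvgD ul vm. Qed.

Lemma cvgsB : (fun n => u n - v n) @ \oo --> l - m.
Proof. exact: cvgB ul vm. Qed.

Lemma cvgsM : (fun n => u n * v n) @ \oo --> l * m.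
Proof. exact: cvgM ul vm. Qed.

Lemma cvgsV : l != 0 -> (fun n => (u n)^-1) @ \oo --> l^-1.
Proof. by move=> l0; exact: (cvgV l0 ul). Qed.

Lemma cvgsMl (c : C) : (fun n => c * u n) @ \oo --> c * l.
Proof. exact: (cvgM (cvg_cst c) ul). Qed.

Lemma cvgsMr (c : C) : (fun n => u n * c) @ \oo --> l * c.
Proof. exact: (cvgM ul (cvg_cst c)). Qed.

End SequenceLimits.

Lemma cvg_cmod (u : nat -> C) (l : C) :
  u @ \oo --> l -> (fun n => cmod (u n)) @ \oo --> cmod l.
Proof.
move=> /cvg_cmodP /cvgrPdist_lt ul; apply/cvgrPdist_lt => e /ul.
apply: filterS => n; rewrite sub0r normrN ger0_norm ?cmod_ge0 //; apply: le_lt_trans.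
have := cmodD (u n - l) l; have := cmodD (l - u n) (u n).
rewrite !subrK -(cmodN (l - _)) opprB => h1 h2.
by rewrite ler_norml; apply/andP; split; lra.
Qed.

Lemma cvg_cmod_le (u : nat -> C) (l : C) (M : R) :
  u @ \oo --> l -> (\forall n \near \oo, cmod (u n) <= M) -> cmod l <= M.
Proof. by move=> /cvg_cmod ul h; apply: (cvgr_to_le ul h). Qed.

Lemma cvg_cmod_ge (u : nat -> C) (l : C) (M : R) :
  u @ \oo --> l -> (\forall n \near \oo, M <= cmod (u n)) -> M <= cmod l.
Proof. by move=> /cvg_cmod ul h; apply: (cvgr_to_ge ul h). Qed.

Lemma cvg_complex_ReIm (u : nat -> C) (x y : R) :
  (fun n => complex.Re (u n)) @ \oo --> x ->
  (fun n => complex.Im (u n)) @ \oo --> y ->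
  u @ \oo --> ((x +i* y)%C : C).
Proof.
move=> ux uy; apply/cvg_cmodP.
apply: (@squeeze_cvgr _ _ _ _ (fun=> 0) (fun n => `|complex.Re (u n) - x| + `|complex.Im (u n) - y|)).
- near=> n; rewrite cmod_ge0 (le_trans (cmod_le_ReIm _)) //.
  by case: (u n).
- exact: cvg_cst.
- rewrite -[0](addr0 0); apply: cvgD.
  + by rewrite -(@normr0 _ R); apply: cvg_norm; rewrite -(subrr x); apply: cvgB => //; apply: cvg_cst.
  + by rewrite -(@normr0 _ R); apply: cvg_norm; rewrite -(subrr y); apply: cvgB => //; apply: cvg_cst.
Unshelve. all: by end_near. Qed.

(** The real and imaginary parts converge absolutely, and [R] is complete. *)
Lemma abs_series_cvg (a : nat -> C) (B : nat -> R) :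
  (forall n, cmod (a n) <= B n) -> cvgn (series B) -> exists l : C, series a @ \oo --> l.
Proof.
move=> aB cB.
have main (f : C -> R) : (forall z, `|f z| <= cmod z) -> (forall x y, f (x + y) = f x + f y) ->
    f 0 = 0 -> cvgn (fun n => f (series a n)).
  move=> fn fD f0; have -> : (fun n => f (series a n)) = series (f \o a).
    by apply/funext => n; rewrite /series /=; elim/big_ind2 : _ => // x1 x2 y1 y2 <- <-.
  apply: normed_cvg; apply: (series_le_cvg _ _ _ cB) => n /=.
  - exact: normr_ge0.
  - exact: le_trans (cmod_ge0 _) (aB n).
  - exact: le_trans (fn _) (aB n).
have cR := main _ le_Re_cmod (fun x y => raddfD _ x y) (raddf0 _).
have cI := main _ le_Im_cmod (fun x y => raddfD _ x y) (raddf0 _).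
by eexists; apply: cvg_complex_ReIm; [exact: cR|exact: cI].
Qed.

End ComplexModulus.
Arguments cvgs_cst {R} c [t] _.
Arguments cvgsMl [R u l] _ c [t] _.
Arguments cvgsMr [R u l] _ c [t] _.

(** * Tannery's theorem *)

Section Tannery.
Variable R : realType.
Local Notation C := (Cplx R).

Lemma series_tail_small (B : nat -> R) (e : R) :
  (forall n, 0 <= B n) -> cvgn (series B) -> 0 < e ->
  exists K, forall n, (K <= n)%N -> \sum_(K <= k < n) B k < e.
Proof.
move=> B0 cB e0.
have [K _ /(_ K (leqnn _)) hK] : \forall n \near \oo, `|limn (series B) - series B n| < e.
  by move: cB => /cvgrPdist_lt /(_ _ e0).
exists K => n Kn; rewrite -sub_series_geq //.
have nd : nondecreasing_seq (series B).
  by apply/nondecreasing_seqP => k; rewrite -subr_ge0 seriesSB.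
have := nondecreasing_cvgn_le nd cB n; move: hK; rewrite /= ltr_norml => /andP[]; lra.
Qed.

(** Finitely many terms converge one by one, and the remaining ones are below a
    tail of [B], whatever the row. *)
Theorem tannery (a : nat -> nat -> C) (A : nat -> C) (l : nat -> C) (L : C)
    (B : nat -> R) :
  (forall k, series (a k) @ \oo --> A k) ->
  (forall k d, cmod (a k d) <= B d) -> cvgn (series B) ->
  (forall d, a^~ d @ \oo --> l d) -> series l @ \oo --> L ->
  A @ \oo --> L.
Proof.
move=> aA aB cB al lL.
have B0 n : 0 <= B n by exact: le_trans (cmod_ge0 _) (aB 0%N n).
have lB d : cmod (l d) <= B d by apply: (cvg_cmod_le (al d)); near=> k; exact: aB.
apply/cvg_cmodP/cvgrPdist_lt => e e0.
have e40 : 0 < e / 4 by lra.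
have [K hK] := series_tail_small B0 cB e40.
have fin : (fun k => \sum_(0 <= d < K) cmod (a k d - l d)) @ \oo --> (0 : R).
  elim: K {hK} => [|K IH].
    by under eq_fun do rewrite big_nil; exact: cvg_cst.
  under eq_fun do rewrite big_nat_recr //=.
  have /cvg_cmodP alK := al K.
  have h : (fun k => \sum_(0 <= d < K) cmod (a k d - l d) + cmod (a k K - l K)) @ \oo --> (0 + 0 : R).
    exact: cvgD.
  by rewrite addr0 in h.
move/cvgrPdist_lt: fin => /(_ _ e40); apply: filterS => k.
rewrite !sub0r !normrN ger0_norm ?sumr_ge0 // => [hk|d _]; last exact: cmod_ge0.
rewrite ger0_norm ?cmod_ge0 //; apply: (@le_lt_trans _ _ (e / 4 + (e / 4 + e / 4))); last by lra.
apply: (@cvg_cmod_le _ (fun n => series (a k) n - series l n)).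
  exact: (cvgB (aA k) lL).
near=> n.
have Kn : (K <= n)%N by near: n; exact: nbhs_infty_ge.
rewrite /series /= -sumrB (le_trans (cmod_sum _ _ _)) //.
rewrite (big_cat_nat (leq0n K) Kn) //= lerD ?(ltW hk) //.
rewrite (@le_trans _ _ (\sum_(K <= i < n) B i + \sum_(K <= i < n) B i)) //.
  rewrite -big_split /= ler_sum // => i _.
  by rewrite (le_trans (cmodB _ _)) // lerD.
by rewrite lerD // ltW // hK.
Unshelve. all: by end_near. Qed.

(** Rows with finitely many terms: the sum of each row exists for free, and its
    length may depend on the row. *)
Corollary tannery_finite (a : nat -> nat -> C) (m : nat -> nat) (l : nat -> C)
    (L : C) (B : nat -> R) :
  (forall k d, (d < m k)%N -> cmod (a k d) <= B d) -> (forall d, 0 <= B d) ->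
  cvgn (series B) ->
  (forall d, \forall k \near \oo, (d < m k)%N) ->
  (forall d, a^~ d @ \oo --> l d) -> series l @ \oo --> L ->
  (fun k => \sum_(0 <= d < m k) a k d) @ \oo --> L.
Proof.
move=> aB B0 cB mk al lL.
apply: (@tannery (fun k d => if (d < m k)%N then a k d else 0) _ l L B).
- move=> k; apply: cvg_near_cst; exists (m k) => // n /= mn.
  rewrite /series /= (big_cat_nat (leq0n _) mn) //= [X in _ + X]big1_seq ?addr0.
    by rewrite [RHS]big_nat; rewrite [LHS]big_nat; apply: eq_bigr => d /andP[_ ->].
  by move=> d; rewrite mem_index_iota /= => /andP[h _]; rewrite ltnNge h.
- by move=> k d; case: ifP => [/aB//|_]; rewrite cmod0.
- exact: cB.
- move=> d; apply: (cvg_near_eq (al d)).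
  by apply: filterS (mk d) => k ->.
- exact: lL.
Qed.

(** The bound passes to the limit of each term. *)
Lemma dominated_limit_cvg (a : nat -> nat -> C) (l : nat -> C) (B : nat -> R) :
  (forall k d, cmod (a k d) <= B d) -> cvgn (series B) ->
  (forall d, a^~ d @ \oo --> l d) -> exists L : C, series l @ \oo --> L.
Proof.
move=> aB cB al; apply: abs_series_cvg cB => d.
by apply: (cvg_cmod_le (al d)); near=> k; exact: aB.
Unshelve. all: by end_near. Qed.

End Tannery.

(** * The infinite products (z; Q) *)

Lemma geometric_sum (F : fieldType) (x : F) n : x != 1 ->
  \sum_(0 <= k < n) x ^+ k = (1 - x ^+ n) / (1 - x).
Proof.
move=> x1; have x1' : 1 - x != 0 by rewrite subr_eq0 eq_sym.
apply: (mulIf x1'); rewrite divfK // big_mkord.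
by rewrite -(opprB (x ^+ n)) subrX1 -(opprB x) mulrN mulrC.
Qed.

(** With [s ^ 2 = r], the product [d s ^ d] is at most [1 + s + ... + s ^ (d - 1)],
    hence bounded: each factor [d] is absorbed by a square root of the ratio. *)
Lemma is_cvg_series_natX_geometric (R : realType) (k : nat) (M r : R) :
  0 <= r < 1 -> cvgn (series (fun d => M * (d%:R ^+ k * r ^+ d))).
Proof.
move=> r01; suff h : cvgn (series (fun d => d%:R ^+ k * r ^+ d)).
  by apply: (is_cvg_seriesZ (f := fun d => d%:R ^+ k * r ^+ d)).
elim: k r r01 => [|k IH] r /andP[r0 r1].
  have -> : (fun d : nat => d%:R ^+ 0 * r ^+ d) = geometric 1 r.
    by apply/funext => d; rewrite expr0.
  by apply: is_cvg_geometric_series; rewrite ger0_norm.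
pose s := Num.sqrt r.
have s0 : 0 <= s by exact: sqrtr_ge0.
have s1 : s < 1 by rewrite -[1]sqrtr1 ltr_sqrt.
have s01 : 0 <= s < 1 by rewrite s0.
have sr : s ^+ 2 = r by exact: sqr_sqrtr.
have ds d : d%:R * s ^+ d <= (1 - s)^-1.
  have h : d%:R * s ^+ d <= \sum_(0 <= i < d) s ^+ i.
    rewrite [X in X <= _](_ : _ = \sum_(0 <= i < d) s ^+ d); last first.
      by rewrite sumr_const_nat subn0 mulr_natl.
    rewrite !big_nat; apply: ler_sum => i /andP[_ id].
    by apply: ler_wiXn2l => //; [exact: ltW s1|exact: ltnW].
  apply: (le_trans h).
  have -> : \sum_(0 <= i < d) s ^+ i = (1 - s ^+ d) / (1 - s).
    by rewrite geometric_sum // lt_eqF.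
  by rewrite ler_pdivrMr ?mulVf ?subr_eq0 ?gt_eqF ?subr_gt0 // gerBl exprn_ge0.
have := @is_cvg_seriesZ _ (fun d => d%:R ^+ k * s ^+ d) (1 - s)^-1 (IH s s01).
apply: series_le_cvg => d /=.
- by rewrite mulr_ge0 ?exprn_ge0.
- by rewrite mulr_ge0 ?mulr_ge0 ?exprn_ge0 // invr_ge0 subr_ge0 ltW.
- have -> : d%:R ^+ k.+1 * r ^+ d = (d%:R * s ^+ d) * (d%:R ^+ k * s ^+ d) :> R.
    by rewrite -sr -exprM mulnC exprM exprS; ring.
  by rewrite ler_wpM2r // mulr_ge0 ?exprn_ge0.
Qed.

Arguments is_cvg_series_natX_geometric {R} k M {r}.

Definition qprod (K : pzRingType) (z Q : K) (j : nat) : K :=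
  \prod_(0 <= k < j) (1 - z * Q ^+ k).

Lemma qprod0 (K : pzRingType) (z Q : K) : qprod z Q 0 = 1.
Proof. exact: big_nil. Qed.

Lemma qprodS (K : pzRingType) (z Q : K) j : qprod z Q j.+1 = qprod z Q j * (1 - z * Q ^+ j).
Proof. exact: big_nat_recr. Qed.

Section QProducts.
Variable R : realType.
Local Notation C := (Cplx R).
Implicit Types (z Q : C).

(** Each factor is at most [1 + rho |Q| ^ k], hence at most [exp (rho |Q| ^ k)]. *)
Lemma qprod_bound z Q (rho : R) j : cmod z <= rho -> cmod Q < 1 ->
  cmod (qprod z Q j) <= expR (rho / (1 - cmod Q)).
Proof.
move=> zr Q1.
have rho0 : 0 <= rho := le_trans (cmod_ge0 z) zr.
apply: (@le_trans _ _ (expR (\sum_(0 <= k < j) rho * cmod Q ^+ k))).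
  rewrite expR_sum cmod_prod; apply: ler_prod => k _; rewrite cmod_ge0 /=.
  rewrite (le_trans (cmodB _ _)) // cmod1 cmodM cmodX.
  apply: le_trans (expR_ge1Dx _); rewrite lerD2l ler_wpM2r ?exprn_ge0 ?cmod_ge0 //.
rewrite ler_expR.
have -> : \sum_(0 <= k < j) rho * cmod Q ^+ k = rho * (1 - cmod Q ^+ j) / (1 - cmod Q).
  by rewrite -mulr_sumr geometric_sum ?lt_eqF // mulrA.
rewrite ler_wpM2r ?invr_ge0 ?subr_ge0 ?(ltW Q1) // ler_piMr // gerBl.
by rewrite exprn_ge0 ?cmod_ge0.
Qed.

(** Telescoping turns the infinite product into a dominated series, so that
    dominated convergence applies to it, in [z] too. *)
Lemma qprod_series z Q n :
  1 + series (fun j => - (qprod z Q j * (z * Q ^+ j))) n = qprod z Q n.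
Proof.
elim: n => [|n IH]; first by rewrite /series /= big_nil addr0 qprod0.
by rewrite seriesSr addrA IH qprodS /=; ring.
Qed.

Lemma qprod_term_bound z Q (rho : R) j : cmod z <= rho -> cmod Q < 1 ->
  cmod (- (qprod z Q j * (z * Q ^+ j))) <=
  expR (rho / (1 - cmod Q)) * rho * (j%:R ^+ 0 * cmod Q ^+ j).
Proof.
move=> zr Q1; rewrite cmodN !cmodM cmodX expr0 mul1r -mulrA.
have rho0 : 0 <= rho := le_trans (cmod_ge0 z) zr.
apply: ler_pM; rewrite ?cmod_ge0 ?mulr_ge0 ?exprn_ge0 ?cmod_ge0 ?qprod_bound //.
by rewrite ler_wpM2r ?exprn_ge0 ?cmod_ge0.
Qed.

Lemma qpoch_cvg z Q : cmod Q < 1 -> qprod z Q @ \oo --> qpoch z Q.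
Proof.
move=> Q1; rewrite /qpoch.
have -> : (fun N => \prod_(1 <= n < N.+1) (1 - z * Q ^+ n.-1)) = qprod z Q.
  by apply/funext => N; rewrite big_add1.
have [l hl] : exists l : C, series (fun j => - (qprod z Q j * (z * Q ^+ j))) @ \oo --> l.
  apply: (@abs_series_cvg _ _ (fun j => expR (cmod z / (1 - cmod Q)) * cmod z * (j%:R ^+ 0 * cmod Q ^+ j))).
    by move=> j; exact: qprod_term_bound.
  by apply: is_cvg_series_natX_geometric; rewrite cmod_ge0.
suff h : qprod z Q @ \oo --> 1 + l by rewrite (cvg_lim _ h).
have -> : qprod z Q = (fun n => 1 + series (fun j => - (qprod z Q j * (z * Q ^+ j))) n).
  by apply/funext => n; rewrite qprod_series.
exact: (cvgD (cvg_cst (1 : C)) hl).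
Qed.

Arguments qpoch_cvg z {Q}.

Lemma qprod_cvg_arg (zk : nat -> C) z Q j :
  zk @ \oo --> z -> (fun k => qprod (zk k) Q j) @ \oo --> qprod z Q j.
Proof.
move=> h; elim: j => [|j IH].
  rewrite qprod0; under eq_fun do rewrite qprod0; exact: cvg_cst.
rewrite qprodS; under eq_fun do rewrite qprodS.
apply: cvgM; first exact: IH.
apply: cvgB; first exact: cvg_cst.
by apply: cvgM; [exact: h|exact: cvg_cst].
Qed.

Lemma qpoch_cvg_arg (zk : nat -> C) z Q (rho : R) : cmod Q < 1 ->
  (forall k, cmod (zk k) <= rho) -> zk @ \oo --> z ->
  (fun k => qpoch (zk k) Q) @ \oo --> qpoch z Q.
Proof.
move=> Q1 zr h.
have ser (w : C) : series (fun j => - (qprod w Q j * (w * Q ^+ j))) @ \oo --> qpoch w Q - 1.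
  have -> : series (fun j => - (qprod w Q j * (w * Q ^+ j))) = (fun n => qprod w Q n - 1).
    by apply/funext => n; rewrite -qprod_series addrC addKr.
  exact: (cvgB (qpoch_cvg w Q1) (cvg_cst (1 : C))).
suff H : (fun k => qpoch (zk k) Q - 1) @ \oo --> qpoch z Q - 1.
  have h1 : (fun k => qpoch (zk k) Q - 1 + 1) @ \oo --> qpoch z Q - 1 + 1.
    exact: (cvgD H (cvg_cst (1 : C))).
  rewrite subrK in h1; apply: (cvg_ext h1) => k; exact: subrK.
apply: (@tannery _ (fun k j => - (qprod (zk k) Q j * (zk k * Q ^+ j))) _ _ _
   (fun j => expR (rho / (1 - cmod Q)) * rho * (j%:R ^+ 0 * cmod Q ^+ j)) _ _ _ _ (ser z)).
- by move=> k; exact: ser.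
- by move=> k j; exact: qprod_term_bound.
- by apply: is_cvg_series_natX_geometric; rewrite cmod_ge0.
- move=> j; apply: cvgN; apply: cvgM; first exact: qprod_cvg_arg.
  by apply: cvgM; [exact: h|exact: cvg_cst].
Unshelve. all: by end_near. Qed.

Lemma qpochS z Q : cmod Q < 1 -> qpoch z Q = (1 - z) * qpoch (z * Q) Q.
Proof.
move=> Q1.
have h1 : (fun n => qprod z Q n.+1) @ \oo --> qpoch z Q.
  by rewrite (cvg_shiftS (qprod z Q)); exact: qpoch_cvg.
have h2 : (fun n => qprod z Q n.+1) @ \oo --> (1 - z) * qpoch (z * Q) Q.
  have -> : (fun n => qprod z Q n.+1) = (fun n => (1 - z) * qprod (z * Q) Q n).
    apply/funext => n; rewrite /qprod big_nat_recl //= expr0 mulr1; congr (_ * _).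
    by apply: eq_bigr => k _; rewrite exprS mulrA.
  by apply: cvgM; [exact: cvg_cst | exact: qpoch_cvg].
exact: (cvg_uniq h1 h2).
Qed.

(** Weierstrass' inequality [\prod (1 - x_k) >= 1 - \sum x_k] keeps the tail of
    the product above [1/2]. *)
Lemma qprod_lower_bound z Q : cmod Q < 1 -> (forall k, 1 - z * Q ^+ k != 0) ->
  exists2 c : R, 0 < c & forall j, c <= cmod (qprod z Q j).
Proof.
move=> Q1 nz.
pose x k := cmod z * cmod Q ^+ k.
have x0 k : 0 <= x k by rewrite mulr_ge0 ?exprn_ge0 ?cmod_ge0.
have cx : cvgn (series x).
  have := @is_cvg_geometric_series _ (cmod z) (cmod Q).
  by rewrite ger0_norm ?cmod_ge0 // => /(_ Q1).
have h20 : 0 < 2^-1 :> R by rewrite invr_gt0.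
have [K hK] := series_tail_small x0 cx h20.
have pos j : 0 < cmod (qprod z Q j).
  by rewrite cmod_gt0 prodf_seq_neq0; apply/allP => k _; apply: nz.
have tail n : cmod (qprod z Q K) * (1 - \sum_(K <= k < K + n) x k) <= cmod (qprod z Q (K + n)).
  elim: n => [|n IH]; first by rewrite addn0 big_geq // subr0 mulr1.
  rewrite addnS qprodS cmodM big_nat_recr ?leq_addr //=.
  have h1 : 1 - x (K + n)%N <= cmod (1 - z * Q ^+ (K + n)).
    have := cmodD (1 - z * Q ^+ (K + n)) (z * Q ^+ (K + n)).
    by rewrite subrK cmod1 cmodM cmodX -/(x _); lra.
  have xK : x (K + n)%N <= 2^-1.
    have := hK (K + n).+1 (leq_trans (leq_addr _ _) (leqnSn _)).
    rewrite big_nat_recr ?leq_addr //=.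
    have : 0 <= \sum_(K <= k < K + n) x k by rewrite sumr_ge0.
    lra.
  have S0 : 0 <= \sum_(K <= k < K + n) x k by rewrite sumr_ge0.
  apply: le_trans (ler_wpM2l (ltW (pos _)) h1).
  have x1 : 0 <= 1 - x (K + n)%N by lra.
  apply: le_trans (ler_wpM2r x1 IH).
  have := mulr_ge0 (mulr_ge0 (ltW (pos K)) S0) (x0 (K + n)%N); lra.
pose m := \big[Num.min/cmod (qprod z Q K) * 2^-1]_(0 <= j < K) cmod (qprod z Q j).
exists m.
  rewrite /m; elim/big_ind : _ => [|x1 x2 h1 h2|j _] //; last first.
    by rewrite lt_min h1.
  by rewrite mulr_gt0 // invr_gt0.
move=> j; have [jK|Kj] := ltnP j K.
  by apply: (@bigmin_inf_seq _ _ _ _ _ j) => //; rewrite mem_index_iota.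
apply: (@le_trans _ _ (cmod (qprod z Q K) * 2^-1)); first exact: bigmin_le_id.
have := tail (j - K)%N; rewrite subnKC //; apply: le_trans.
rewrite ler_wpM2l ?cmod_ge0 //; have := hK j Kj; lra.
Qed.

Lemma qpoch_neq0 z Q : cmod Q < 1 -> (forall k, 1 - z * Q ^+ k != 0) ->
  qpoch z Q != 0.
Proof.
move=> Q1 nz; have [c c0 hc] := qprod_lower_bound Q1 nz.
rewrite -cmod_gt0; apply: lt_le_trans c0 _.
by apply: (cvg_cmod_ge (qpoch_cvg z Q1)); near=> n; exact: hc.
Unshelve. all: by end_near. Qed.


End QProducts.
Arguments qpoch_cvg {R} z {Q}.

(** * Two finite identities *)

Section FiniteIdentities.
Variable F : fieldType.
Implicit Types (z a t A Q : F).

Lemma qprod_cat z Q m n :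
  qprod z Q (m + n) = qprod z Q m * qprod (z * Q ^+ m) Q n.
Proof.
rewrite /qprod (big_cat_nat (leq0n m) (leq_addr n m)) /=; congr (_ * _).
rewrite -{1}[m]add0n big_addn addKn.
by apply: eq_bigr => i _; rewrite -mulrA -exprD addnC.
Qed.

Lemma qprod_neq0 z Q n : (forall k, (k < n)%N -> 1 - z * Q ^+ k != 0) ->
  qprod z Q n != 0.
Proof.
by move=> nz; rewrite prodf_seq_neq0; apply/allP => k; rewrite mem_index_iota => /nz.
Qed.

(** Taking [- z / Q ^ j] out of each factor: the products with negative powers of
    [Q] become products in [Q / z]. *)
Lemma qprod_reflect z Q n : z != 0 -> Q != 0 ->
  qprod (z / Q ^+ n) Q n = z ^+ n * \prod_(0 <= k < n) (- Q ^- k.+1) * qprod (Q / z) Q n.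
Proof.
move=> z0 Q0; have -> : z ^+ n = \prod_(0 <= k < n) z by rewrite prodr_const_nat subn0.
rewrite /qprod -!big_split /= big_nat_rev /= [LHS]big_nat [RHS]big_nat; apply: eq_bigr => k /andP[_ kn].
rewrite add0n -[in Q ^- n](subnK kn) exprD invfM.
rewrite -[X in 1 - X]mulrA [_ * _ * Q ^+ _]mulrAC mulVf ?expf_neq0 // mul1r.
by rewrite exprS; field; rewrite z0 Q0 expf_neq0.
Qed.

(** The coefficient of [1 / (1 - A Q ^ n)] in the partial fraction decomposition
    of [finite_kronecker]. *)
Definition kronecker_coef t Q M n :=
  t ^+ n * (qprod (Q / t) Q n * qprod t Q (M - n))
    / (qprod Q Q n * qprod Q Q (M.-1 - n)).

(** A finite form of Kronecker's formula, by partial fractions in [A]. Going from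
    [M] to [M + 1], the old coefficients get a factor that depends on [M - n] only,
    and the coefficient at the new pole [A = Q ^ - M] is given by the left-hand
    side for [M] at that point. *)
Lemma finite_kronecker t Q A M : t != 0 -> Q != 0 ->
  (forall n, 1 - Q ^+ n.+1 != 0) -> (forall n, (n < M)%N -> 1 - A * Q ^+ n != 0) ->
  qprod (A * t) Q M / qprod A Q M =
  t ^+ M + \sum_(0 <= n < M) kronecker_coef t Q M n / (1 - A * Q ^+ n).
Proof.
move=> t0 Q0 Qn; have qQ n : qprod Q Q n != 0.
  by apply: qprod_neq0 => k _; rewrite -exprS.
elim: M A => [|M IH] A An; first by rewrite /qprod !big_nil divr1 addr0.
have AM : 1 - A * Q ^+ M != 0 by exact: An.
have {}An n : (n < M)%N -> 1 - A * Q ^+ n != 0 by move=> h; apply: An; exact: ltnW.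
have E1 := IH A An.
(* the induction hypothesis at the new pole *)
have E2 : t ^+ M * qprod (Q / t) Q M / qprod Q Q M =
    t ^+ M + \sum_(0 <= n < M) kronecker_coef t Q M n / (1 - Q ^- (M - n)).
  have nz n : (n < M)%N -> 1 - Q ^- M * Q ^+ n != 0.
    move=> nM; rewrite -[in Q ^- M](subnK (ltnW nM)) exprD invfM divfK ?expf_neq0 //.
    rewrite subr_eq0 eq_sym invr_eq1 eq_sym -subr_eq0.
    by have := Qn (M - n).-1; rewrite prednK ?subn_gt0.
  have := IH (Q ^- M) nz; rewrite [_ * t]mulrC qprod_reflect //.
  have := @qprod_reflect 1 Q M (oner_neq0 F) Q0; rewrite mul1r divr1 expr1n mul1r => ->.
  set e := \prod_(0 <= k < M) _; have e0 : e != 0.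
    by rewrite prodf_seq_neq0; apply/allP => k _; rewrite oppr_eq0 invr_eq0 expf_neq0.
  have -> : t ^+ M * e * qprod (Q / t) Q M / (e * qprod Q Q M) =
            t ^+ M * qprod (Q / t) Q M / qprod Q Q M.
    by field; rewrite e0 qQ.
  move=> ->; congr (_ + _); rewrite !big_nat; apply: eq_bigr => n /andP[_ nM].
  by rewrite -[in Q ^- M](subnK (ltnW nM)) exprD invfM divfK ?expf_neq0.
have E3 n : (n < M)%N -> kronecker_coef t Q M.+1 n =
    kronecker_coef t Q M n * ((1 - t * Q ^+ (M - n)) / (1 - Q ^+ (M - n))).
  move=> nM; rewrite /kronecker_coef /=.
  have [m mE] : exists m, (M - n = m.+1)%N by exists (M - n).-1; lia.
  have -> : (M.+1 - n = m.+2)%N by lia.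
  have -> : (M.-1 - n = m)%N by lia.
  rewrite mE !(qprodS _ _ m.+1) (qprodS Q Q m) -exprS.
  by field; rewrite Qn !qQ.
rewrite !qprodS big_nat_recr //=.
have -> : kronecker_coef t Q M.+1 M = (1 - t) * (t ^+ M * qprod (Q / t) Q M / qprod Q Q M).
  rewrite /kronecker_coef subSnn subnn qprodS !qprod0 expr0 mulr1 mul1r.
  by field; rewrite qQ.
rewrite E2 invfM mulrACA E1 mulrDl.
have -> : \sum_(0 <= n < M) kronecker_coef t Q M.+1 n / (1 - A * Q ^+ n) =
   \sum_(0 <= n < M) (kronecker_coef t Q M n / (1 - A * Q ^+ n)) * ((1 - A * t * Q ^+ M) / (1 - A * Q ^+ M))
  - (1 - t) * (\sum_(0 <= n < M) kronecker_coef t Q M n / (1 - Q ^- (M - n))) / (1 - A * Q ^+ M).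
  rewrite mulr_sumr mulr_suml -sumrB !big_nat; apply: eq_bigr => n /andP[_ nM].
  rewrite E3 //; have Qn' : 1 - Q ^+ (M - n) != 0.
    by have := Qn (M - n).-1; rewrite prednK ?subn_gt0.
  have -> : Q ^+ M = Q ^+ (M - n) * Q ^+ n by rewrite -exprD subnK // ltnW.
  move: AM (An _ nM); rewrite -(subnK (ltnW nM)) exprD addnK.
  move: Qn'; set q := Q ^+ (M - n); set y := Q ^+ n => h1 h2 h3.
  have q0 : q != 0 by rewrite expf_neq0.
  field.
  by rewrite h2 q0 h3 h1 -opprB oppr_eq0 h1.
rewrite -mulr_suml exprS; field.
exact: AM.
Qed.

(** The product [phi i * (1 - phi j)] is a multiple of [phi i - phi j] when
    [i != j], so that the product of the two sums telescopes along the lines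
    [i - j = d]. *)
Lemma finite_square t Q A M (phi := fun i => (1 - A * Q ^+ i)^-1) : t != 0 -> Q != 0 ->
  (forall n, 1 - Q ^+ n.+1 != 0) -> (forall n, (n < M)%N -> 1 - A * Q ^+ n != 0) ->
  (\sum_(0 <= i < M) t ^+ i * phi i) * (\sum_(0 <= j < M) t ^- j * (1 - phi j)) =
  - \sum_(0 <= i < M) A * Q ^+ i * phi i ^+ 2 +
  \sum_(1 <= d < M) (t ^+ d + (Q / t) ^+ d) / (1 - Q ^+ d) *
     (\sum_(M - d <= k < M) phi k - \sum_(0 <= k < d) phi k).
Proof.
move=> t0 Q0 Qn; elim: M => [|M IH] An; first by rewrite !big_nil mul0r oppr0 addr0.
have AM : 1 - A * Q ^+ M != 0 by exact: An.
have {}An n : (n < M)%N -> 1 - A * Q ^+ n != 0 by move=> h; apply: An; exact: ltnW.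
have {}IH := IH An.
rewrite !(big_nat_recr M 0) //=.
have -> : \sum_(1 <= d < M.+1) (t ^+ d + (Q / t) ^+ d) / (1 - Q ^+ d) *
     (\sum_(M.+1 - d <= k < M.+1) phi k - \sum_(0 <= k < d) phi k) =
  \sum_(1 <= d < M) (t ^+ d + (Q / t) ^+ d) / (1 - Q ^+ d) *
     (\sum_(M - d <= k < M) phi k - \sum_(0 <= k < d) phi k) +
  \sum_(1 <= d < M.+1) (t ^+ d + (Q / t) ^+ d) / (1 - Q ^+ d) * (phi M - phi (M - d)%N).
  have -> : \sum_(1 <= d < M) (t ^+ d + (Q / t) ^+ d) / (1 - Q ^+ d) *
     (\sum_(M - d <= k < M) phi k - \sum_(0 <= k < d) phi k) =
    \sum_(1 <= d < M.+1) (t ^+ d + (Q / t) ^+ d) / (1 - Q ^+ d) *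
     (\sum_(M - d <= k < M) phi k - \sum_(0 <= k < d) phi k).
    case: M {IH AM An} => [|M]; first by rewrite !big_geq.
    by rewrite [RHS]big_nat_recr //= subnn subrr mulr0 addr0.
  rewrite -big_split /= !big_nat; apply: eq_bigr => d /andP[d0 dM].
  rewrite -mulrDr; congr (_ * _).
  have h : (M - d <= M)%N by exact: leq_subr.
  have -> : \sum_(M.+1 - d <= k < M.+1) phi k = \sum_(M - d <= k < M) phi k + phi M - phi (M - d)%N.
    rewrite -big_nat_recr //= [in RHS]big_ltn ?ltnS // subSn //.
    by rewrite [RHS]addrC addKr.
  ring.
have S : \sum_(1 <= d < M.+1) (t ^+ d + (Q / t) ^+ d) / (1 - Q ^+ d) * (phi M - phi (M - d)%N) =
   \sum_(0 <= j < M) (t ^+ M * phi M * (t ^- j * (1 - phi j)) + t ^+ j * phi j * (t ^- M * (1 - phi M))).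
  rewrite big_add1 /= big_nat_rev /= !big_nat; apply: eq_bigr => j /andP[_ jM].
  have -> : (0 + M - j.+1).+1 = (M - j)%N by lia.
  rewrite subKn ?(ltnW jM) // /phi expr_div_n.
  have Qd : 1 - Q ^+ (M - j) != 0.
    by have := Qn (M - j).-1; rewrite prednK ?subn_gt0.
  have QM : Q ^+ M = Q ^+ (M - j) * Q ^+ j by rewrite -exprD subnK // ltnW.
  have tM : t ^+ M = t ^+ (M - j) * t ^+ j by rewrite -exprD subnK // ltnW.
  move: AM (An _ jM); rewrite QM tM => h2 h3.
  by field; rewrite !expf_neq0 // h2 h3 Qd.
rewrite !mulrDl !mulrDr IH S big_split /= -mulr_sumr -mulr_suml.
have -> : A * Q ^+ M * phi M ^+ 2 = (phi M - 1) * phi M.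
  by rewrite /phi; field; exact: AM.
by field; exact: expf_neq0.
Qed.

End FiniteIdentities.

(** * Kronecker's formula *)

(** The theta product [(x, Q / x; Q)]; the eta quotients are quotients of its
    values at powers of [q], with [Q = q ^ p]. *)
Definition theta (R : realType) (x Q : Cplx R) : Cplx R := qpoch2 x (Q / x) Q.

Lemma sum_split_center (V : nmodType) (g : nat -> V) N :
  \sum_(0 <= i < N.*2.+1) g i =
  \sum_(0 <= k < N.+1) g (N + k)%N + \sum_(0 <= k < N) g (N - k.+1)%N.
Proof.
have h : (N <= N.*2.+1)%N by rewrite -addnn; lia.
rewrite (big_cat_nat (leq0n N) h) /= addrC; congr (_ + _).
  rewrite -{1}[N]add0n big_addn; have -> : (N.*2.+1 - N = N.+1)%N by rewrite -addnn; lia.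
  by apply: eq_bigr => i _; rewrite addnC.
by rewrite big_nat_rev /= !big_nat; apply: eq_bigr => i _; rewrite add0n.
Qed.

Section KroneckerLimit.
Variable R : realType.
Local Notation C := (Cplx R).
Implicit Types (z Q t a : C).

Lemma cvg_index (u : nat -> C) (l : C) (f : nat -> nat) :
  (forall m, \forall N \near \oo, (m <= f N)%N) ->
  u @ \oo --> l -> (fun N => u (f N)) @ \oo --> l.
Proof.
move=> fN ul B /ul [M _ hM]; apply: filterS (fN M) => N h.
exact: hM.
Qed.

Lemma cvg_exp0 Q : cmod Q < 1 -> (fun n => Q ^+ n) @ \oo --> (0 : C).
Proof.
move=> Q1; apply/cvg_cmodP.
have := @cvg_geometric R 1 (cmod Q); rewrite ger0_norm ?cmod_ge0 // => /(_ Q1).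
have -> // : geometric 1 (cmod Q) = (fun n => cmod (Q ^+ n - 0)).
by apply/funext => n; rewrite /= mul1r subr0 cmodX.
Qed.

(** A factor is the quotient of two consecutive partial products, which are
    bounded and bounded away from zero. *)
Lemma factor_inv_bound z Q : cmod Q < 1 -> (forall k, 1 - z * Q ^+ k != 0) ->
  exists2 c : R, 0 <= c & forall k, cmod (1 - z * Q ^+ k)^-1 <= c.
Proof.
move=> Q1 nz; have [c c0 hc] := qprod_lower_bound Q1 nz.
exists (expR (cmod z / (1 - cmod Q)) / c); first by rewrite mulr_ge0 ?expR_ge0 ?invr_ge0 ?ltW.
move=> k; have q0 n : qprod z Q n != 0 by apply: qprod_neq0 => i _; exact: nz.
have -> : (1 - z * Q ^+ k)^-1 = qprod z Q k / qprod z Q k.+1.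
  by rewrite qprodS invfM mulVKf.
rewrite cmodM cmodV ler_pM ?invr_ge0 ?cmod_ge0 ?qprod_bound //.
by rewrite lef_pV2 ?posrE ?cmod_gt0.
Qed.

Lemma Qpow_neq1 Q : cmod Q < 1 -> forall n, 1 - Q ^+ n.+1 != 0.
Proof.
move=> Q1 n; rewrite subr_eq0 eq_sym; apply/eqP => h.
have : cmod (Q ^+ n.+1) < 1 by rewrite cmodX exprn_ilt1 ?cmod_ge0.
by rewrite h cmod1 ltxx.
Qed.

Variables (Q : C).
Hypotheses (Q0 : Q != 0) (Q1 : cmod Q < 1).

(** No power of [Q], positive or negative, equals [a]: the poles of Kronecker's
    function in [a] are avoided. Negative powers are cleared so that only natural
    exponents occur. *)
Definition generic a := [/\ a != 0, forall k, 1 - a * Q ^+ k != 0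
  & forall k, 1 - a^-1 * Q ^+ k.+1 != 0].

Let qQ n : qprod Q Q n != 0.
Proof. by apply: qprod_neq0 => k _; rewrite -exprS Qpow_neq1. Qed.

Let QQ0 : qpoch Q Q != 0.
Proof. by apply: qpoch_neq0 => // k; rewrite -exprS Qpow_neq1. Qed.

Lemma generic_annulus a : cmod Q < cmod a < 1 -> generic a.
Proof.
move=> /andP[Qa a1].
have a0 : a != 0 by rewrite -cmod_gt0 (le_lt_trans (cmod_ge0 Q)).
have lt1 x k : cmod x < 1 -> 1 - x * Q ^+ k != 0.
  move=> x1; rewrite subr_eq0; apply/eqP => h.
  have : cmod (x * Q ^+ k) < 1.
    rewrite cmodM cmodX; apply: le_lt_trans x1; apply: ler_piMr; first exact: cmod_ge0.
    by apply: exprn_ile1; [exact: cmod_ge0 | exact: ltW].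
  by rewrite -h cmod1 ltxx.
split=> // k; first exact: lt1.
rewrite exprS mulrA; apply: lt1.
by rewrite cmodM cmodV mulrC ltr_pdivrMr ?cmod_gt0 // mul1r.
Qed.

Lemma theta_neq0 a : generic a -> theta a Q != 0.
Proof.
case=> a0 h1 h2; rewrite mulf_neq0 // qpoch_neq0 // => k.
by rewrite [Q / a]mulrC -mulrA -exprS.
Qed.

Lemma genericV a : generic a -> generic a^-1.
Proof.
case=> a0 h1 h2; split; rewrite ?invr_eq0 // => k; last by rewrite invrK.
case: k => [|k]; last exact: h2.
rewrite expr0 mulr1 subr_eq0 eq_sym invr_eq1 eq_sym -subr_eq0.
by have := h1 0%N; rewrite expr0 mulr1.
Qed.

(** The partial sum of [t ^ n / (1 - a Q ^ n)] over [-N <= n <= N], shifted by [N]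
    so that the exponents are natural numbers. *)
Definition center_sum a t N :=
  t ^- N * \sum_(0 <= i < N.*2.+1) t ^+ i / (1 - a / Q ^+ N * Q ^+ i).

(** The value of Kronecker's series [sum t ^ n / (1 - a Q ^ n)] over all integers
    [n], for [|Q| < |t| < 1]; see [center_sum_cvg]. *)
Definition kron a t := qpoch Q Q ^+ 2 * theta (a * t) Q / (theta a Q * theta t Q).

(* the ratio between a coefficient of the finite formula and the power of [t] to
   which it is attached; its limit does not depend on the index *)
Let W t i j := qprod (Q / t) Q i * qprod t Q j / (qprod Q Q i * qprod Q Q j.-1).

Lemma center_negE a k N : generic a -> (k < N)%N ->
  (1 - a / Q ^+ N * Q ^+ (N - k.+1))^-1 = - (a^-1 * Q ^+ k.+1) / (1 - a^-1 * Q ^+ k.+1).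
Proof.
move=> [a0 h1 h2] kN; rewrite -{1}(subnK kN) exprD.
have : Q ^+ (N - k.+1) != 0 by rewrite expf_neq0.
have : Q ^+ k.+1 != 0 by rewrite expf_neq0.
move: (h2 k); set x := Q ^+ k.+1; set y := Q ^+ (N - _) => n0 x0 y0.
have ax : a - x != 0 by move: n0; rewrite -(mulVf a0) -mulrBr mulf_eq0 negb_or => /andP[].
rewrite invfM; field.
by rewrite a0 x0 y0 ax -opprB oppr_eq0 ax.
Qed.

Lemma center_neg_neq0 a k N : generic a -> (k < N)%N ->
  1 - a / Q ^+ N * Q ^+ (N - k.+1) != 0.
Proof.
move=> ga kN; rewrite -invr_eq0 center_negE //; case: ga => a0 _ h2.
by rewrite mulf_neq0 ?oppr_eq0 ?invr_eq0 ?mulf_neq0 ?invr_eq0 ?expf_neq0.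
Qed.

Lemma center_posE a k N : a / Q ^+ N * Q ^+ (N + k) = a * Q ^+ k.
Proof. by rewrite exprD mulrA divfK ?expf_neq0. Qed.

Lemma center_neq0 a N n : generic a -> 1 - a / Q ^+ N * Q ^+ n != 0.
Proof.
move=> ga; have [Nn|nN] := leqP N n.
  by rewrite -(subnKC Nn) center_posE; case: ga.
have -> : n = (N - (N - n.+1).+1)%N by lia.
by apply: center_neg_neq0 => //; lia.
Qed.

(* the terms of index [k] and of index [- (k + 1)] *)
Let pos a t k : C := t ^+ k / (1 - a * Q ^+ k).
Let neg a t k : C := (Q / t) ^+ k.+1 * (- a^-1 / (1 - a^-1 * Q ^+ k.+1)).

Lemma center_sumE a t N : generic a -> t != 0 ->
  center_sum a t N = \sum_(0 <= k < N.+1) pos a t k + \sum_(0 <= k < N) neg a t k.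
Proof.
move=> ga t0; rewrite /center_sum sum_split_center mulrDr !mulr_sumr; congr (_ + _).
  apply: eq_bigr => k _; rewrite center_posE exprD /pos.
  by rewrite !mulrA mulVf ?expf_neq0 // mul1r.
rewrite !big_nat; apply: eq_bigr => k /andP[_ kN].
rewrite center_negE // /neg expr_div_n.
have -> : t ^+ N = t ^+ (N - k.+1) * t ^+ k.+1 by rewrite -exprD subnK.
move: (a^-1) (1 - _)^-1 => b w.
by field; rewrite !expf_neq0.
Qed.

Section Fixed.
Variables a t : C.
Hypotheses (ga : generic a) (t1 : cmod Q < cmod t < 1).

Let gt : generic t := generic_annulus t1.
Let t0 : t != 0. Proof. by case: gt. Qed.
Let Qt1 : cmod (Q / t) < 1.
Proof.
by move/andP: t1 => [h _]; rewrite cmodM cmodV ltr_pdivrMr ?mul1r // cmod_gt0.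
Qed.

Lemma W_bound : exists2 c : R, 0 <= c & forall i j, cmod (W t i j) <= c.
Proof.
have [c c0 hc] : exists2 c : R, 0 < c & forall j, c <= cmod (qprod Q Q j).
  by apply: qprod_lower_bound => // k; rewrite -exprS Qpow_neq1.
pose e z : R := expR (cmod z / (1 - cmod Q)).
exists (e (Q / t) * e t / (c * c)).
  by rewrite !mulr_ge0 ?expR_ge0 ?invr_ge0 ?mulr_ge0 ?ltW.
move=> i j; rewrite cmodM cmodV !cmodM.
apply: ler_pM; rewrite ?invr_ge0 ?mulr_ge0 ?cmod_ge0 //.
  by apply: ler_pM; rewrite ?cmod_ge0 ?qprod_bound.
rewrite lef_pV2 ?posrE ?mulr_gt0 ?cmod_gt0 //.
by apply: ler_pM; rewrite ?(ltW c0).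
Qed.

Let Winf := theta t Q / qpoch Q Q ^+ 2.

Lemma W_cvg (f g : nat -> nat) :
  (forall m, \forall N \near \oo, (m <= f N)%N) ->
  (forall m, \forall N \near \oo, (m <= g N)%N) ->
  (fun N => W t (f N) (g N)) @ \oo --> Winf.
Proof.
move=> fN gN.
have gN' m : \forall N \near \oo, (m <= (g N).-1)%N.
  by apply: filterS (gN m.+1) => N; lia.
have h1 := cvg_index fN (qpoch_cvg (Q / t) Q1).
have h2 := cvg_index gN (qpoch_cvg t Q1).
have h3 := cvg_index fN (qpoch_cvg Q Q1).
have h4 := cvg_index gN' (qpoch_cvg Q Q1).
have q2 : qpoch Q Q * qpoch Q Q != 0 by rewrite mulf_neq0.
have -> : Winf = qpoch (Q / t) Q * qpoch t Q / (qpoch Q Q * qpoch Q Q).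
  by rewrite /Winf /theta /qpoch2 expr2 [qpoch t Q * _]mulrC.
exact: (cvgM (cvgM h1 h2) (cvgV q2 (cvgM h3 h4))).
Qed.

(** The finite formula at [A = a / Q ^ N] with [2 N + 1] poles, divided by [t ^ N]:
    the poles are now centered at [n = 0], and both sides have a limit. *)
Lemma finite_kronecker_centered N :
  qprod (Q / (a * t)) Q N * qprod (a * t) Q N.+1 / (qprod (Q / a) Q N * qprod a Q N.+1) =
  t ^+ N.+1 + \sum_(0 <= k < N.+1) pos a t k * W t (N + k) (N.+1 - k) +
  \sum_(0 <= k < N) neg a t k * W t (N - k.+1) (N + k.+2).
Proof.
have [a0 h1 h2] := ga.
have An n := center_neq0 N n ga.
have E := finite_kronecker t0 Q0 (Qpow_neq1 Q1) (fun n (_ : (n < N.*2.+1)%N) => An n).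
have M2 : (N.*2.+1 = N + N.+1)%N by rewrite -addnn addnS.
transitivity (t ^- N * (qprod (a / Q ^+ N * t) Q N.*2.+1 / qprod (a / Q ^+ N) Q N.*2.+1)).
  have -> : a / Q ^+ N * t = a * t / Q ^+ N by rewrite mulrAC.
  rewrite M2 !qprod_cat !qprod_reflect ?mulf_neq0 // !divfK ?expf_neq0 //.
  set e := \prod_(0 <= k < N) _; have e0 : e != 0.
    by rewrite prodf_seq_neq0; apply/allP => k _; rewrite oppr_eq0 invr_eq0 expf_neq0.
  have n1 : qprod (Q / a) Q N != 0.
    by apply: qprod_neq0 => k _; rewrite [Q / a]mulrC -mulrA -exprS.
  have n2 : qprod a Q N.+1 != 0 by apply: qprod_neq0.
  by rewrite exprMn; field; rewrite n1 n2 e0 !expf_neq0.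
rewrite E mulrDr sum_split_center mulrDr addrA !mulr_sumr; congr (_ + _ + _).
- by rewrite M2 exprD mulKf ?expf_neq0.
- rewrite !big_nat; apply: eq_bigr => k /andP[_ kN]; rewrite center_posE.
  rewrite /kronecker_coef /pos /W exprD.
  have -> : (N.*2.+1 - (N + k) = N.+1 - k)%N by lia.
  have -> : (N.*2.+1.-1 - (N + k) = (N.+1 - k).-1)%N by lia.
  by rewrite !mulrA mulVf ?expf_neq0 // mul1r; ring.
- rewrite !big_nat; apply: eq_bigr => k /andP[_ kN]; rewrite center_negE //.
  rewrite /kronecker_coef /neg /W.
  have -> : (N.*2.+1 - (N - k.+1) = N + k.+2)%N by lia.
  have -> : (N.*2.+1.-1 - (N - k.+1) = (N + k.+2).-1)%N by lia.
  have -> : t ^+ N = t ^+ (N - k.+1) * t ^+ k.+1 by rewrite -exprD subnK.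
  rewrite expr_div_n invfM.
  move: (a^-1) (1 - _)^-1 => b w.
  by field; rewrite !qQ !expf_neq0.
Qed.

Lemma pos_bound : exists2 c : R, 0 <= c &
  forall k, cmod (pos a t k) <= c * (k%:R ^+ 0 * cmod t ^+ k).
Proof.
have [_ h1 _] := ga; have [c c0 hc] := factor_inv_bound Q1 h1.
exists c => // k; rewrite expr0 mul1r cmodM cmodX mulrC.
by rewrite ler_wpM2r ?exprn_ge0 ?cmod_ge0.
Qed.

Lemma neg_bound : exists2 c : R, 0 <= c &
  forall k, cmod (neg a t k) <= c * (k%:R ^+ 0 * cmod (Q / t) ^+ k).
Proof.
have [_ _ h2] := ga.
have [c c0 hc] : exists2 c : R, 0 <= c & forall k, cmod (1 - a^-1 * Q * Q ^+ k)^-1 <= c.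
  by apply: factor_inv_bound => // k; rewrite -mulrA -exprS.
exists (cmod a^-1 * c) => [|k]; first by rewrite mulr_ge0 ?cmod_ge0.
have -> : cmod (neg a t k) =
    cmod a^-1 * cmod (1 - a^-1 * Q ^+ k.+1)^-1 * (cmod (Q / t) * cmod (Q / t) ^+ k).
  by rewrite /neg !cmodM cmodN cmodX exprS cmodM; ring.
rewrite expr0 mul1r.
apply: ler_pM; rewrite ?mulr_ge0 ?cmod_ge0 ?exprn_ge0 ?cmod_ge0 //.
  by rewrite ler_wpM2l ?cmod_ge0 // exprS mulrA.
by rewrite ler_piMl ?exprn_ge0 ?cmod_ge0 // ltW.
Qed.

Let t01 : 0 <= cmod t < 1.
Proof. by rewrite cmod_ge0; case/andP: t1. Qed.
Let Qt01 : 0 <= cmod (Q / t) < 1.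
Proof. by rewrite cmod_ge0. Qed.

(** Let [N] tend to infinity in the centered formula: the left-hand side tends to
    [theta (a t) / theta a], and the coefficients on the right to a common factor
    [Winf] times those of Kronecker's series. *)
Lemma center_sum_cvg : center_sum a t @ \oo --> kron a t.
Proof.
have [cp cp0 hp] := pos_bound; have [cn cn0 hn] := neg_bound.
have [cW cW0 hW] := W_bound.
have [Sp hSp] := abs_series_cvg hp (is_cvg_series_natX_geometric 0 cp t01).
have [Sn hSn] := abs_series_cvg hn (is_cvg_series_natX_geometric 0 cn Qt01).
have scale (u : nat -> C) (S w : C) : series u @ \oo --> S ->
    series (fun k => u k * w) @ \oo --> S * w.
  move=> h; apply: (cvg_ext (cvgsMr h w)) => n.
  by rewrite /series /= mulr_suml.
have Tp : (fun N => \sum_(0 <= k < N.+1) pos a t k * W t (N + k) (N.+1 - k)) @ \oo --> Sp * Winf.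
  apply: (@tannery_finite _ (fun N k => pos a t k * W t (N + k) (N.+1 - k)) (fun N => N.+1)
    (fun k => pos a t k * Winf) _ (fun k => cp * cW * (k%:R ^+ 0 * cmod t ^+ k))).
  - move=> N k _; rewrite cmodM mulrAC; apply: ler_pM; rewrite ?cmod_ge0 //.
  - by move=> d; rewrite !mulr_ge0 ?exprn_ge0 ?cmod_ge0.
  - exact: is_cvg_series_natX_geometric.
  - by move=> d; near=> N; rewrite ltnS; near: N; exact: nbhs_infty_ge.
  - move=> d; apply: (cvgM (cvg_cst (pos a t d))); apply: W_cvg => m; near=> N.
      rewrite (leq_trans _ (leq_addr _ _)) //; near: N; exact: nbhs_infty_ge.
    have : (m + d <= N)%N by near: N; exact: nbhs_infty_ge.
    lia.
  - exact: scale.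
have Tn : (fun N => \sum_(0 <= k < N) neg a t k * W t (N - k.+1) (N + k.+2)) @ \oo --> Sn * Winf.
  apply: (@tannery_finite _ (fun N k => neg a t k * W t (N - k.+1) (N + k.+2)) (fun N => N)
    (fun k => neg a t k * Winf) _ (fun k => cn * cW * (k%:R ^+ 0 * cmod (Q / t) ^+ k))).
  - move=> N k _; rewrite cmodM mulrAC; apply: ler_pM; rewrite ?cmod_ge0 //.
  - by move=> d; rewrite !mulr_ge0 ?exprn_ge0 ?cmod_ge0.
  - exact: is_cvg_series_natX_geometric.
  - by move=> d; exact: nbhs_infty_gt.
  - move=> d; apply: (cvgM (cvg_cst (neg a t d))); apply: W_cvg => m; near=> N.
      have : (m + d.+1 <= N)%N by near: N; exact: nbhs_infty_ge.
      lia.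
    rewrite (leq_trans _ (leq_addr _ _)) //; near: N; exact: nbhs_infty_ge.
  - exact: scale.
have t0cvg : (fun N => t ^+ N.+1) @ \oo --> (0 : C).
  by rewrite (cvg_shiftS (fun N => t ^+ N)); apply: cvg_exp0; case/andP: t01.
have Hr := cvgsD (cvgsD t0cvg Tp) Tn.
have succ m : \forall N \near \oo, (m <= N.+1)%N by near=> N; rewrite ltnW // ltnS; near: N; exact: nbhs_infty_ge.
have tha : qpoch (Q / a) Q * qpoch a Q != 0.
  by rewrite mulrC; exact: theta_neq0.
have Hl := cvgsM (cvgsM (qpoch_cvg (Q / (a * t)) Q1) (cvg_index succ (qpoch_cvg (a * t) Q1)))
  (cvgsV (cvgsM (qpoch_cvg (Q / a) Q1) (cvg_index succ (qpoch_cvg a Q1))) tha).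
have Hl' : (fun N => t ^+ N.+1 + \sum_(0 <= k < N.+1) pos a t k * W t (N + k) (N.+1 - k) +
  \sum_(0 <= k < N) neg a t k * W t (N - k.+1) (N + k.+2)) @ \oo --> theta (a * t) Q / theta a Q.
  rewrite /theta /qpoch2 [qpoch (a * t) Q * _]mulrC [qpoch a Q * _]mulrC.
  apply: (cvg_ext Hl) => N; exact: finite_kronecker_centered.
have E : theta (a * t) Q / theta a Q = 0 + Sp * Winf + Sn * Winf := cvg_uniq Hl' Hr.
have -> : kron a t = Sp + Sn.
  have th_t : theta t Q != 0 by exact: theta_neq0.
  have th_a : theta a Q != 0 by exact: theta_neq0.
  have -> : kron a t = theta (a * t) Q / theta a Q / Winf.
    by rewrite /kron /Winf; field; rewrite th_t th_a QQ0.
  rewrite E add0r -mulrDl mulfK // /Winf mulf_neq0 // invr_eq0 expf_neq0 //.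
have Hp' : (fun N => \sum_(0 <= k < N.+1) pos a t k) @ \oo --> Sp.
  exact: (cvg_index succ hSp).
apply: (cvg_ext (cvgsD Hp' hSn)) => N.
by rewrite center_sumE.
Unshelve. all: by end_near. Qed.

End Fixed.

End KroneckerLimit.

(** * The product of two Kronecker series *)

Section SquareLimit.
Variable R : realType.
Local Notation C := (Cplx R).
Variable Q : C.
Hypotheses (Q0 : Q != 0) (Q1 : cmod Q < 1).
Implicit Types a t : C.

(** The coefficient of the telescoped boundary terms in [finite_square]. *)
Definition lambert_weight t d := (t ^+ d + (Q / t) ^+ d) / (1 - Q ^+ d).

Let phi a N k := (1 - a / Q ^+ N * Q ^+ k)^-1.

(** The terms with equal indices in the product of two Kronecker series. They do
    not involve [t]. *)
Definition diagonal_sum a N :=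
  \sum_(0 <= i < N.*2.+1) a / Q ^+ N * Q ^+ i * phi a N i ^+ 2.

(** Reversing the order of summation, since [1 / (1 - 1 / x) = 1 - 1 / (1 - x)]. *)
Lemma center_sumV a t N : generic Q a -> t != 0 ->
  t ^- N * center_sum Q a^-1 t N =
  \sum_(0 <= j < N.*2.+1) t ^- j * (1 - phi a N j).
Proof.
move=> ga t0; rewrite /center_sum mulrA mulr_sumr big_nat_rev /= !big_nat.
apply: eq_bigr => j /andP[_ jN].
have -> : (0 + N.*2.+1 - j.+1 = N.*2 - j)%N by lia.
have := center_neq0 Q0 Q1 N j ga; rewrite /phi.
have e : t ^+ (N.*2 - j) = t ^+ N * t ^+ N / t ^+ j.
  by apply: (canRL (mulfK _)); rewrite ?expf_neq0 // -!exprD subnK ?addnn //; lia.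
have -> : a^-1 / Q ^+ N * Q ^+ (N.*2 - j) = (a / Q ^+ N * Q ^+ j)^-1.
  have e' : Q ^+ (N.*2 - j) = Q ^+ N * Q ^+ N / Q ^+ j.
    by apply: (canRL (mulfK _)); rewrite ?expf_neq0 // -!exprD subnK ?addnn //; lia.
  by rewrite e'; field; rewrite !expf_neq0 //; case: ga => -> _ _.
have : a / Q ^+ N * Q ^+ j != 0 by rewrite !mulf_neq0 ?invr_eq0 ?expf_neq0 //; case: ga.
move: (a / Q ^+ N * Q ^+ j) => x x0 x1; rewrite e.
by field; rewrite !expf_neq0 // x0 x1 -opprB oppr_eq0 x1.
Qed.

Lemma center_sum_prod a t N : generic Q a -> t != 0 ->
  center_sum Q a t N * center_sum Q a^-1 t N =
  - diagonal_sum a N + \sum_(0 <= d < N.*2.+1) lambert_weight t d *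
    (\sum_(0 <= i < d) phi a N (N.*2 - i) - \sum_(0 <= k < d) phi a N k).
Proof.
move=> ga t0.
have := finite_square t0 Q0 (Qpow_neq1 Q1) (fun n (_ : (n < N.*2.+1)%N) => center_neq0 Q0 Q1 N n ga).
rewrite -/(phi a N) -center_sumV // => E.
transitivity (t ^- N * (\sum_(0 <= i < N.*2.+1) t ^+ i * phi a N i) * center_sum Q a^-1 t N) => //.
rewrite -[LHS]mulrA mulrCA E; congr (_ + _).
rewrite [RHS]big_ltn // !(big_geq (leqnn 0)) subrr mulr0 add0r !big_nat.
apply: eq_bigr => d /andP[d0 dN]; congr (_ * (_ - _)).
have -> : (N.*2.+1 - d = 0 + (N.*2.+1 - d))%N by [].
rewrite big_addn big_nat_rev /= subKn; last by rewrite ltnW.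
rewrite !big_nat; apply: eq_bigr => i /andP[_ id]; congr (phi _ _ _); lia.
Qed.

Lemma phi_bound a : generic Q a -> exists2 c : R, 0 <= c & forall N k, cmod (phi a N k) <= c.
Proof.
move=> ga; have [a0 h1 h2] := ga.
have [c c0 hc] := factor_inv_bound Q1 h1.
have [c' c'0 hc'] : exists2 c : R, 0 <= c & forall k, cmod (1 - a^-1 * Q * Q ^+ k)^-1 <= c.
  by apply: factor_inv_bound => // k; rewrite -mulrA -exprS.
exists (c + cmod a^-1 * c'); first by rewrite addr_ge0 ?mulr_ge0 ?cmod_ge0.
move=> N k; have [Nk|kN] := leqP N k.
  rewrite -(subnKC Nk) /phi center_posE // (le_trans (hc _)) // lerDl.
  by rewrite mulr_ge0 ?cmod_ge0.
have -> : k = (N - (N - k.+1).+1)%N by lia.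
rewrite /phi center_negE //; last by lia.
rewrite cmodM cmodN cmodM ler_wpDl //; apply: ler_pM; rewrite ?mulr_ge0 ?cmod_ge0 //.
  by rewrite ler_piMr ?cmod_ge0 // cmodX exprn_ile1 ?cmod_ge0 // ltW.
by rewrite exprS mulrA.
Qed.

Lemma phi_low_cvg a k : generic Q a -> (fun N => phi a N k) @ \oo --> (0 : C).
Proof.
move=> ga.
have h : (fun N => Q ^+ (N - k)) @ \oo --> (0 : C).
  apply: (cvg_index _ (cvg_exp0 Q1)) => m; near=> N.
  have : (m + k <= N)%N by near: N; exact: nbhs_infty_ge.
  lia.
have h1 := cvgsMl h a^-1.
have n0 : (1 : C) - a^-1 * 0 != 0 by rewrite mulr0 subr0 oner_eq0.
have := cvgsM (cvgsMl h1 (-1)) (cvgsV (cvgsB (cvgs_cst 1) h1) n0).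
rewrite !mulr0 mul0r => h2; apply: (cvg_near_eq h2); near=> N.
have kN : (k < N)%N by near: N; exact: nbhs_infty_gt.
rewrite [in RHS](_ : k = (N - (N - k.+1).+1)%N); last by lia.
rewrite /phi center_negE //; last by lia.
by rewrite mulN1r; have -> : (N - k.+1).+1 = (N - k)%N by lia.
Unshelve. all: by end_near. Qed.

Lemma phi_high_cvg a i : generic Q a -> (fun N => phi a N (N.*2 - i)) @ \oo --> (1 : C).
Proof.
move=> ga.
have h : (fun N => Q ^+ (N - i)) @ \oo --> (0 : C).
  apply: (cvg_index _ (cvg_exp0 Q1)) => m; near=> N.
  have : (m + i <= N)%N by near: N; exact: nbhs_infty_ge.
  lia.
have h1 := cvgsMl h a.
have n0 : (1 : C) - a * 0 != 0 by rewrite mulr0 subr0 oner_eq0.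
have := cvgsV (cvgsB (cvgs_cst 1) h1) n0.
rewrite mulr0 subr0 invr1 => h2; apply: (cvg_near_eq h2); near=> N.
have iN : (i <= N)%N by near: N; exact: nbhs_infty_ge.
have -> : (N.*2 - i = N + (N - i))%N by lia.
rewrite /phi center_posE //.
Unshelve. all: by end_near. Qed.

Lemma cvgs_sum (u : nat -> nat -> C) (l : nat -> C) n :
  (forall i, u i @ \oo --> l i) ->
  (fun N => \sum_(0 <= i < n) u i N) @ \oo --> \sum_(0 <= i < n) l i.
Proof.
move=> ul; elim: n => [|n IH].
  by rewrite big_nil; apply: (cvg_ext (cvgs_cst 0)) => N; rewrite big_nil.
rewrite (big_nat_recr _ _ _ (leq0n n)) /=; apply: (cvg_ext (cvgsD IH (ul n))) => N.
by rewrite big_nat_recr.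
Qed.

Lemma lambert_weight_bound t : cmod Q < cmod t < 1 ->
  exists2 c : R, 0 <= c & exists2 rho : R, 0 <= rho < 1 &
  forall d, cmod (lambert_weight t d) <= c * rho ^+ d.
Proof.
move=> /andP[Qt t1].
have t0 : 0 < cmod t := le_lt_trans (cmod_ge0 Q) Qt.
have [c c0 hc] : exists2 c : R, 0 <= c & forall k, cmod (1 - Q * Q ^+ k)^-1 <= c.
  by apply: factor_inv_bound => // k; rewrite -exprS Qpow_neq1.
pose rho := Num.max (cmod t) (cmod (Q / t)).
have r0 : 0 <= rho by rewrite le_max cmod_ge0.
exists (2 * c); first by rewrite mulr_ge0.
exists rho; first by rewrite r0 gt_max t1 cmodM cmodV ltr_pdivrMr // mul1r.
case=> [|d].
  by rewrite /lambert_weight expr0 subrr invr0 mulr0 cmod0 !mulr_ge0 ?exprn_ge0.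
rewrite /lambert_weight exprS [Q ^+ d.+1]exprS cmodM mulrAC.
apply: ler_pM; rewrite ?cmod_ge0 // -exprS mulr_natl mulr2n.
rewrite (le_trans (cmodD _ _)) // !cmodX lerD // lerXn2r ?nnegrE ?cmod_ge0 //.
  by rewrite le_max lexx.
by rewrite le_max lexx orbT.
Qed.

Lemma lambert_cvg t : cmod Q < cmod t < 1 ->
  exists L : C, series (fun d => d%:R * lambert_weight t d) @ \oo --> L.
Proof.
move=> t1; have [c c0 [rho r1 hc]] := lambert_weight_bound t1.
apply: (@abs_series_cvg _ _ (fun d => c * (d%:R ^+ 1 * rho ^+ d))).
  move=> d; rewrite cmodM cmod_nat expr1 mulrCA.
  by rewrite ler_wpM2l.
exact: is_cvg_series_natX_geometric.
Qed.

(** In [finite_square], the [d] upper values of [phi] tend to [1] and the [d] lower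
    ones to [0], so the off-diagonal part tends to the Lambert series in [t]. The
    convergence of the diagonal part then follows from Kronecker's formula. *)
Lemma diagonal_sum_cvg a t (L : C) : generic Q a -> cmod Q < cmod t < 1 ->
  series (fun d => d%:R * lambert_weight t d) @ \oo --> L ->
  diagonal_sum a @ \oo --> L - kron Q a t * kron Q a^-1 t.
Proof.
move=> ga t1 hL.
have gt := generic_annulus Q1 t1; have t0 : t != 0 by case: gt.
have [c c0 [rho r1 hc]] := lambert_weight_bound t1.
have [cp cp0 hcp] := phi_bound ga.
have T : (fun N => \sum_(0 <= d < N.*2.+1) lambert_weight t d *
    (\sum_(0 <= i < d) phi a N (N.*2 - i) - \sum_(0 <= k < d) phi a N k)) @ \oo --> L.
  apply: (@tannery_finite _ (fun N d => lambert_weight t d *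
    (\sum_(0 <= i < d) phi a N (N.*2 - i) - \sum_(0 <= k < d) phi a N k)) (fun N => N.*2.+1)
    (fun d => d%:R * lambert_weight t d) _
    (fun d => c * (2 * cp) * (d%:R ^+ 1 * rho ^+ d))).
  - move=> N d _; rewrite cmodM.
    have hs (u : nat -> C) : (forall i, cmod (u i) <= cp) -> cmod (\sum_(0 <= i < d) u i) <= d%:R * cp.
      move=> hu; rewrite (le_trans (cmod_sum _ _ _)) //.
      rewrite mulr_natl -{2}(subn0 d) -sumr_const_nat; exact: ler_sum.
    rewrite expr1 [X in _ <= X](_ : _ = c * rho ^+ d * (d%:R * cp + d%:R * cp)); last by ring.
    apply: ler_pM; rewrite ?cmod_ge0 //.
    by rewrite (le_trans (cmodB _ _)) // lerD // hs.
  - by move=> d; case/andP: r1 => r0 _; rewrite !mulr_ge0 ?exprn_ge0.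
  - exact: is_cvg_series_natX_geometric.
  - move=> d; near=> N; have : (d <= N)%N by near: N; exact: nbhs_infty_ge.
    lia.
  - move=> d; rewrite mulrC.
    have h1 := @cvgs_sum (fun i N => phi a N (N.*2 - i)) (fun=> 1) d (fun i => phi_high_cvg i ga).
    have h2 := @cvgs_sum (fun k N => phi a N k) (fun=> 0) d (fun i => phi_low_cvg i ga).
    have h3 := cvgsMl (cvgsB h1 h2) (lambert_weight t d).
    rewrite sumr_const_nat big1_eq subr0 subn0 in h3; exact: h3.
  - exact: hL.
have K := cvgsM (center_sum_cvg Q0 Q1 ga t1) (center_sum_cvg Q0 Q1 (genericV ga) t1).
apply: (cvg_ext (cvgsB T K)) => N.
by rewrite center_sum_prod //; ring.
Unshelve. all: by end_near. Qed.

End SquareLimit.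

(** * Theta products as Lambert series *)

Section LambertThetaIdentities.
Variable R : realType.
Local Notation C := (Cplx R).
Variable Q : C.
Hypotheses (Q0 : Q != 0) (Q1 : cmod Q < 1).
Implicit Types a t z : C.

Lemma theta_inv z : z != 0 -> theta z^-1 Q = - theta z Q / z.
Proof.
move=> z0; rewrite /theta /qpoch2 invrK (qpochS z^-1 Q1) (qpochS z Q1).
by rewrite [Q * z]mulrC [z^-1 * Q]mulrC; field.
Qed.

Lemma kron_prod a t : generic Q a -> generic Q t ->
  kron Q a t * kron Q a^-1 t =
  - (a * qpoch Q Q ^+ 4 * theta (a * t) Q * theta (t / a) Q
     / (theta a Q ^+ 2 * theta t Q ^+ 2)).
Proof.
move=> ga gt; have a0 : a != 0 by case: ga.
rewrite /kron theta_inv // [a^-1 * t]mulrC.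
by field; rewrite a0 !theta_neq0.
Qed.

Definition lambert t : C := limn (series (fun d => d%:R * lambert_weight Q t d)).

Lemma lambertP t : cmod Q < cmod t < 1 ->
  series (fun d => d%:R * lambert_weight Q t d) @ \oo --> lambert t.
Proof. by move=> /(lambert_cvg Q1) [L hL]; rewrite /lambert (cvg_lim _ hL). Qed.

Lemma theta_cvg_arg (zk : nat -> C) z (lo hi : R) : 0 < lo ->
  (forall k, lo <= cmod (zk k) <= hi) -> zk @ \oo --> z -> z != 0 ->
  (fun k => theta (zk k) Q) @ \oo --> theta z Q.
Proof.
move=> lo0 hz cz z0.
have h1 := qpoch_cvg_arg Q1 (fun k => proj2 (andP (hz k))) cz.
have cz' : (fun k => Q / zk k) @ \oo --> Q / z by exact: (cvgsMl (cvgsV cz z0) Q).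
have h2 := qpoch_cvg_arg (rho := cmod Q / lo) Q1 _ cz'.
apply: cvgsM; first exact: h1.
apply: h2 => k; have /andP[h _] := hz k.
rewrite cmodM cmodV ler_wpM2l ?cmod_ge0 // lef_pV2 ?posrE //.
exact: lt_le_trans h.
Qed.

(** The diagonal limit is independent of [t], and is found by letting [t] tend to
    [a]: the product of the two Kronecker functions vanishes at [t = a]. Dividing
    by [1 - t / a] before passing to the limit differentiates the identity, which
    gives the one of weight 3. *)
Section Degeneration.
Variable a : C.
Hypothesis a1 : cmod Q < cmod a < 1.

Let ga : generic Q a := generic_annulus Q1 a1.
Let a0 : a != 0. Proof. by case: ga. Qed.
Let na0 : 0 < cmod a. Proof. by rewrite cmod_gt0. Qed.

(* [t = a s k] with [s k] real, increasing to [1]; [m] is chosen so that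
   [|Q| < |a| m], which keeps [t] in the annulus *)
Let m : R := (cmod Q / cmod a + 1) / 2.
Let x k : R := 1 - (1 - m) * 2^-1 ^+ k.
Let s k : C := (x k)%:C%C.

Let Qa1 : cmod Q / cmod a < 1.
Proof. by rewrite ltr_pdivrMr // mul1r; case/andP: a1. Qed.
Let m1 : m < 1. Proof. by rewrite /m; have := Qa1; move: (cmod Q / cmod a) => y; lra. Qed.
Let mQ : cmod Q < cmod a * m.
Proof. by rewrite mulrC -ltr_pdivrMr // /m; have := Qa1; move: (cmod Q / cmod a) => y; lra. Qed.
Let m0 : 0 < m.
Proof. by rewrite -(pmulr_rgt0 _ na0) (le_lt_trans (cmod_ge0 Q)). Qed.

Let xP k : m <= x k < 1.
Proof.
have h1 : (2^-1 : R) ^+ k <= 1 by rewrite exprn_ile1 ?invr_ge0 // invf_le1 // ler1n.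
have h0 : 0 < (2^-1 : R) ^+ k by rewrite exprn_gt0 // invr_gt0.
have m10 : 0 < 1 - m by rewrite subr_gt0.
rewrite /x; apply/andP; split; last by rewrite gtrBl mulr_gt0.
by rewrite lerBrDr -lerBrDl ler_piMr // ltW.
Qed.

Let cmod_s k : cmod (s k) = x k.
Proof. by rewrite cmod_real gtr0_norm // (lt_le_trans m0) //; case/andP: (xP k). Qed.

Let s0 k : s k != 0.
Proof. by rewrite -cmod_gt0 cmod_s (lt_le_trans m0) //; case/andP: (xP k). Qed.

Let s1 k : 1 - s k != 0.
Proof.
rewrite subr_eq0; apply/eqP => h; have : cmod (s k) < 1 by rewrite cmod_s; case/andP: (xP k).
by rewrite -h cmod1 ltxx.
Qed.

Let s_cvg : s @ \oo --> (1 : C).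
Proof.
have h2 : cmod (2^-1 : C) < 1 by rewrite cmodV cmod_nat invf_lt1 // ltr1n.
have := cvgsB (cvgs_cst 1) (cvgsMl (cvg_exp0 h2) (1 - m)%:C%C).
rewrite mulr0 subr0 => h; apply: (cvg_ext h) => k.
by rewrite /s /x [RHS]rmorphB [in RHS]rmorphM [in RHS]rmorphXn fmorphV rmorph_nat rmorph1.
Qed.

Let as1 k : cmod Q < cmod (a * s k) < 1.
Proof.
have /andP[xm x1] := xP k; have /andP[_ na1] := a1.
rewrite cmodM cmod_s; apply/andP; split.
  by apply: lt_le_trans mQ _; rewrite ler_pM2l.
apply: le_lt_trans na1; rewrite ler_piMr ?cmod_ge0 //; exact: ltW.
Qed.

Let scaled_cvg (z : C) : (fun k => z * s k) @ \oo --> z.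
Proof. by have := cvgsMl s_cvg z; rewrite mulr1. Qed.

Let scaled_bounds (z : C) k : cmod z * m <= cmod (z * s k) <= cmod z.
Proof.
have /andP[xm x1] := xP k.
by rewrite cmodM cmod_s ler_wpM2l ?cmod_ge0 //= ler_piMr ?cmod_ge0 // ltW.
Qed.

Definition weight3_product :=
  a * qpoch Q Q ^+ 6 * theta (a ^+ 2) Q / theta a Q ^+ 4.

(** The vanishing factor of the product is [theta (s k)], and [1 - s k] divides it. *)
Lemma kron_prod_quotient_cvg :
  (fun k => kron Q a (a * s k) * kron Q a^-1 (a * s k) / (1 - s k)) @ \oo -->
  - weight3_product.
Proof.
have theta_scaled (z : C) : z != 0 -> (fun k => theta (z * s k) Q) @ \oo --> theta z Q.
  move=> z0; have zm : 0 < cmod z * m by rewrite mulr_gt0 ?cmod_gt0.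
  exact: (theta_cvg_arg zm (scaled_bounds z) (@scaled_cvg z) z0).
have thsE k : theta (s k) Q / (1 - s k) = qpoch (Q * s k) Q * qpoch (Q / s k) Q.
  rewrite /theta /qpoch2 (qpochS (s k) Q1) [s k * Q]mulrC; field; exact: s1.
have h1 : (fun k => qpoch (Q * s k) Q) @ \oo --> qpoch Q Q.
  exact: (qpoch_cvg_arg Q1 (fun k => proj2 (andP (scaled_bounds Q k))) (@scaled_cvg Q)).
have h2 : (fun k => qpoch (Q / s k) Q) @ \oo --> qpoch Q Q.
  apply: (qpoch_cvg_arg (rho := cmod Q / m) Q1) => [k|].
    rewrite cmodM cmodV cmod_s ler_wpM2l ?cmod_ge0 // lef_pV2 ?posrE //; first by case/andP: (xP k).
    by apply: lt_le_trans m0 _; case/andP: (xP k).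
  have := cvgsMl (cvgsV s_cvg (oner_neq0 _)) Q; rewrite invr1 mulr1; exact.
have tha : theta a Q != 0 by exact: theta_neq0.
have d0 : theta a Q ^+ 2 * (theta a Q * theta a Q) != 0 by rewrite -expr2 -exprD expf_neq0.
have ths := theta_scaled a a0.
have H := cvgsM (cvgsMl (cvgsM (theta_scaled _ (expf_neq0 2 a0)) (cvgsM h1 h2)) (- (a * qpoch Q Q ^+ 4)))
  (cvgsV (cvgsMl (cvgsM ths ths) (theta a Q ^+ 2)) d0).
have -> : - weight3_product = - (a * qpoch Q Q ^+ 4) *
    (theta (a ^+ 2) Q * (qpoch Q Q * qpoch Q Q)) / (theta a Q ^+ 2 * (theta a Q * theta a Q)).
  by rewrite /weight3_product; field.
apply: (cvg_ext H) => k.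
have gas := generic_annulus Q1 (as1 k).
rewrite kron_prod // -thsE.
have -> : a * s k / a = s k by rewrite mulrC mulKf.
have -> : a * (a * s k) = a ^+ 2 * s k by ring.
field.
by rewrite s1 !theta_neq0.
Qed.

Let G k d : C := \sum_(0 <= i < d) s k ^+ i.

Lemma lambert_weight_quotient k d :
  (lambert_weight Q (a * s k) d - lambert_weight Q a d) / (1 - s k) =
  G k d * (((Q / (a * s k)) ^+ d - a ^+ d) / (1 - Q ^+ d)).
Proof.
have GE : G k d = (1 - s k ^+ d) / (1 - s k).
  by rewrite /G geometric_sum //; apply: contra (s1 k) => /eqP ->; rewrite subrr.
rewrite GE /lambert_weight !expr_div_n !exprMn.
move: (1 - Q ^+ d)^-1 => w.
field; rewrite s1 !expf_neq0 //.
Qed.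

(** Termwise, a difference of [d]-th powers divided by [1 - s k] is a sum of [d]
    powers, bounded by [d] and tending to [d]. *)
Lemma lambert_quotient_cvg (L : C) :
  series (fun d => d%:R ^+ 2 * ((a ^+ d - (Q / a) ^+ d) / (1 - Q ^+ d))) @ \oo --> L ->
  (fun k => (lambert (a * s k) - lambert a) / (1 - s k)) @ \oo --> - L.
Proof.
move=> hL.
pose rho := Num.max (cmod a) (cmod Q / (cmod a * m)).
have am0 : 0 < cmod a * m by rewrite mulr_gt0.
have r0 : 0 <= rho by rewrite le_max ltW.
have r1 : rho < 1 by rewrite gt_max ltr_pdivrMr // mul1r mQ andbT; case/andP: a1.
have [c c0 hc] : exists2 c : R, 0 <= c & forall k, cmod (1 - Q * Q ^+ k)^-1 <= c.
  by apply: factor_inv_bound => // k; rewrite -exprS Qpow_neq1.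
apply: (@tannery _ (fun k d => d%:R * (G k d * (((Q / (a * s k)) ^+ d - a ^+ d) / (1 - Q ^+ d))))
   _ (fun d => - (d%:R ^+ 2 * ((a ^+ d - (Q / a) ^+ d) / (1 - Q ^+ d)))) _
   (fun d => (2 * c) * (d%:R ^+ 2 * rho ^+ d))).
- move=> k; apply: (cvg_ext (cvgsMr (cvgsB (lambertP (as1 k)) (lambertP a1)) (1 - s k)^-1)) => n.
  rewrite /series /= -sumrB mulr_suml; apply: eq_bigr => d _.
  by rewrite -lambert_weight_quotient; ring.
- move=> k [|d].
    by rewrite mul0r cmod0 !mulr_ge0 ?exprn_ge0.
  have hG : cmod (G k d.+1) <= d.+1%:R.
    rewrite (le_trans (cmod_sum _ _ _)) //.
    rewrite [X in _ <= X](_ : _ = \sum_(0 <= i < d.+1) 1); last by rewrite sumr_const_nat subn0.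
    apply: ler_sum => i _; rewrite cmodX cmod_s exprn_ile1 //; case/andP: (xP k) => h1 h2.
      exact: ltW (lt_le_trans m0 h1).
    exact: ltW.
  have hq : cmod ((Q / (a * s k)) ^+ d.+1 - a ^+ d.+1) <= 2 * rho ^+ d.+1.
    rewrite (le_trans (cmodB _ _)) // mulr_natl mulr2n !cmodX lerD // lerXn2r ?nnegrE ?cmod_ge0 //.
      rewrite cmodM cmodV le_max; apply/orP; right.
      rewrite ler_wpM2l ?cmod_ge0 // lef_pV2 ?posrE //; first by case/andP: (scaled_bounds a k).
      by rewrite cmod_gt0 mulf_neq0.
    by rewrite le_max lexx.
  rewrite !cmodM cmod_nat.
  have -> : 2 * c * (d.+1%:R ^+ 2 * rho ^+ d.+1) = d.+1%:R * (d.+1%:R * (2 * rho ^+ d.+1 * c)) by ring.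
  rewrite ler_wpM2l //; apply: ler_pM; rewrite ?mulr_ge0 ?cmod_ge0 //.
  by apply: ler_pM; rewrite ?cmod_ge0 // exprS.
- by apply: is_cvg_series_natX_geometric; rewrite r0.
- move=> d.
  have hG : (fun k => G k d) @ \oo --> (d%:R : C).
    have := @cvgs_sum R (fun i k => s k ^+ i) (fun=> 1) d _.
    rewrite sumr_const_nat subn0; apply=> i.
    elim: i => [|i IH]; first exact: (cvg_ext (cvgs_cst 1)).
    by have := cvgsM s_cvg IH; rewrite mulr1 => h; apply: (cvg_ext h) => k; rewrite exprS.
  have hpow : (fun k => (Q / (a * s k)) ^+ d) @ \oo --> (Q / a) ^+ d.
    elim: d {hG} => [|d IH]; first exact: (cvg_ext (cvgs_cst 1)).
    have := cvgsM (cvgsMl (cvgsV (@scaled_cvg a) a0) Q) IH.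
    by rewrite -exprS => h; apply: (cvg_ext h) => k; rewrite exprS.
  have H := cvgsMl (cvgsM hG (cvgsMr (cvgsB hpow (cvgs_cst (a ^+ d))) (1 - Q ^+ d)^-1)) d%:R.
  have -> : - (d%:R ^+ 2 * ((a ^+ d - (Q / a) ^+ d) / (1 - Q ^+ d))) =
     d%:R * (d%:R * (((Q / a) ^+ d - a ^+ d) / (1 - Q ^+ d))) by ring.
  exact: H.
- have := cvgsMl hL (-1); rewrite mulN1r => h; apply: (cvg_ext h) => n.
  by rewrite mulN1r /series /= sumrN.
Qed.

Lemma lambert3_cvg : exists L : C,
  series (fun d => d%:R ^+ 2 * ((a ^+ d - (Q / a) ^+ d) / (1 - Q ^+ d))) @ \oo --> L.
Proof.
pose rho := Num.max (cmod a) (cmod Q / cmod a).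
have r0 : 0 <= rho by rewrite le_max ltW.
have r1 : rho < 1 by rewrite gt_max Qa1 andbT; case/andP: a1.
have [c c0 hc] : exists2 c : R, 0 <= c & forall k, cmod (1 - Q * Q ^+ k)^-1 <= c.
  by apply: factor_inv_bound => // k; rewrite -exprS Qpow_neq1.
apply: (@abs_series_cvg _ _ (fun d => 2 * c * (d%:R ^+ 2 * rho ^+ d))) => [[|d]|].
- by rewrite expr0n mul0r cmod0 !mulr_ge0 ?exprn_ge0.
- rewrite cmodM cmodX cmod_nat cmodM [X in _ <= X]mulrCA ler_wpM2l ?exprn_ge0 // [X in _ <= X]mulrAC.
  apply: ler_pM; rewrite ?cmod_ge0 //; last by rewrite exprS.
  rewrite (le_trans (cmodB _ _)) // mulr_natl mulr2n !cmodX lerD // lerXn2r ?nnegrE ?cmod_ge0 //.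
    by rewrite le_max lexx.
  by rewrite cmodM cmodV le_max lexx orbT.
- by apply: is_cvg_series_natX_geometric; rewrite r0.
Qed.

(** Both the Lambert series and the product of Kronecker functions at [a s k] are
    known to first order in [1 - s k]; comparing the orders 0 and 1 gives the two
    statements. *)
Lemma degeneration : diagonal_sum Q a @ \oo --> lambert a /\
  series (fun d => d%:R ^+ 2 * ((a ^+ d - (Q / a) ^+ d) / (1 - Q ^+ d))) @ \oo -->
  weight3_product.
Proof.
have [L hL] := lambert3_cvg.
have hA := lambert_quotient_cvg hL.
have hE := kron_prod_quotient_cvg.
have hD k := diagonal_sum_cvg Q0 Q1 ga (as1 k) (lambertP (as1 k)).
pose D := lambert (a * s 0) - kron Q a (a * s 0) * kron Q a^-1 (a * s 0).
have hK k : lambert (a * s k) - kron Q a (a * s k) * kron Q a^-1 (a * s k) = D.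
  exact: cvg_uniq (hD k) (hD 0%N).
have s10 : (fun k => 1 - s k) @ \oo --> (0 : C).
  by have := cvgsB (cvgs_cst 1) s_cvg; rewrite subrr.
have l1 : (fun k => lambert (a * s k)) @ \oo --> D.
  have := cvgsD (cvgsM s10 hE) (cvgs_cst D); rewrite mul0r add0r => h.
  apply: (cvg_ext h) => k; rewrite -(hK k) mulrC divfK ?s1 //; ring.
have l2 : (fun k => lambert (a * s k)) @ \oo --> lambert a.
  have := cvgsD (cvgsM s10 hA) (cvgs_cst (lambert a)); rewrite mul0r add0r => h.
  by apply: (cvg_ext h) => k; rewrite mulrC divfK ?s1 // subrK.
have DE : D = lambert a := cvg_uniq l1 l2.
split; first by rewrite -DE; exact: (hD 0%N).
suff : - L = - weight3_product by move/oppr_inj => <-.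
apply: cvg_uniq hA _; apply: (cvg_ext hE) => k.
by rewrite -DE -(hK k); congr (_ / _); ring.
Qed.

End Degeneration.

(** The product formula for the derivative of Weierstrass' function. *)
Theorem weight3_identity a : cmod Q < cmod a < 1 ->
  series (fun d => d%:R ^+ 2 * ((a ^+ d - (Q / a) ^+ d) / (1 - Q ^+ d))) @ \oo -->
  a * qpoch Q Q ^+ 6 * theta (a ^+ 2) Q / theta a Q ^+ 4.
Proof. by move=> a1; case: (degeneration a1). Qed.

(** The product formula for the difference of two values of Weierstrass' function. *)
Theorem weight2_identity a t : cmod Q < cmod a < 1 -> cmod Q < cmod t < 1 ->
  series (fun d => d%:R * (lambert_weight Q a d - lambert_weight Q t d)) @ \oo -->
  a * qpoch Q Q ^+ 4 * theta (a * t) Q * theta (t / a) Q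
     / (theta a Q ^+ 2 * theta t Q ^+ 2).
Proof.
move=> a1 t1; have ga := generic_annulus Q1 a1; have gt := generic_annulus Q1 t1.
have [hD _] := degeneration a1.
have E := cvg_uniq hD (diagonal_sum_cvg Q0 Q1 ga t1 (lambertP t1)).
set P := (X in _ --> X); have -> : P = lambert a - lambert t.
  rewrite E kron_prod // -/P; ring.
apply: (cvg_ext (cvgsB (lambertP a1) (lambertP t1))) => n.
by rewrite /series /= -sumrB; apply: eq_bigr => d _; rewrite mulrBr.
Qed.

End LambertThetaIdentities.

(** * Uniqueness of power series *)

Section PowerSeries.
Variable R : realType.
Local Notation C := (Cplx R).

Lemma cvg_bounded (u : nat -> C) (l : C) : u @ \oo --> l -> exists M : R, forall n, cmod (u n) <= M.
Proof.
move=> /cvg_cmod ul; have cu : cvgn (fun n => cmod (u n)) by apply/cvg_ex; exists (cmod l); exact: ul.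
have [M hM] := cvg_has_ub cu; exists M => n; apply: hM => /=.
by exists n => //; rewrite ger0_norm ?cmod_ge0.
Qed.

Lemma cvg_series_terms_bounded (a : nat -> C) (l : C) : series a @ \oo --> l ->
  exists2 M : R, 0 <= M & forall n, cmod (a n) <= M.
Proof.
move=> /cvg_bounded [M hM]; have M0 := le_trans (cmod_ge0 _) (hM 0%N).
exists (M + M) => [|n]; first by rewrite addr_ge0.
by rewrite -seriesSB (le_trans (cmodB _ _)) // lerD.
Qed.

Lemma geometric_tail_le (y : R) n N : 0 <= y <= 2^-1 ->
  \sum_(n <= k < N) y ^+ k <= 2 * y ^+ n.
Proof.
move=> /andP[y0 y1]; have [Nn|nN] := leqP N n.
  by rewrite big_geq // mulr_ge0 ?exprn_ge0.
have -> : \sum_(n <= k < N) y ^+ k = y ^+ n * \sum_(0 <= k < N - n) y ^+ k.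
  rewrite -{1}[n]add0n big_addn mulr_sumr; apply: eq_bigr => i _.
  by rewrite exprD mulrC.
have y1' : y != 1 by apply/eqP; lra.
rewrite geometric_sum // mulrC ler_wpM2r ?exprn_ge0 //.
have : 0 <= y ^+ (N - n) by exact: exprn_ge0.
move: (y ^+ _) => w w0; rewrite ler_pdivrMr; lra.
Qed.

(** Otherwise the nonzero term of lowest degree would dominate the others as [r]
    tends to [0]. *)
Lemma power_series_eq0 (d : nat -> C) :
  (forall r : R, 0 < r < 1 -> series (fun n => d n * (r%:C%C : C) ^+ n) @ \oo --> (0 : C)) ->
  forall n, d n = 0.
Proof.
move=> hd n; have [m] := ubnP n; elim: m n => // m IH n; rewrite ltnS => nm.
have {IH}d0 k : (k < n)%N -> d k = 0 by move=> kn; apply: IH; exact: leq_trans nm.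
have h2 : 0 < (2^-1 : R) < 1 by apply/andP; split; lra.
have [M M0 hM] := cvg_series_terms_bounded (hd _ h2).
(* convergence at [1 / 2] bounds the coefficients *)
have dM k : cmod (d k) <= M * 2 ^+ k.
  have := hM k; rewrite cmodM cmodX cmod_real ger0_norm ?invr_ge0 // exprVn.
  by rewrite ler_pdivrMr // exprn_gt0.
have key (r : R) : 0 < r <= 4^-1 -> cmod (d n) <= 2 * M * 2 ^+ n.+1 * r.
  move=> /andP[r0 r4].
  have r1 : 0 < r < 1 by apply/andP; split; lra.
  have H : cmod (d n) * r ^+ n - M * (2 * (2 * r) ^+ n.+1) <= cmod (0 : C).
    apply: (cvg_cmod_ge (hd _ r1)); near=> N.
    have nN : (n < N)%N by near: N; exact: nbhs_infty_gt.
    rewrite /series /= (big_cat_nat (leq0n n) (ltnW nN)) /=.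
    rewrite big1_seq ?add0r; last first.
      by move=> k; rewrite mem_index_iota /= => kn; rewrite d0 ?mul0r.
    rewrite big_ltn // lerBlDr.
    set T := \sum_(n.+1 <= k < N) _.
    have hT : cmod T <= M * (2 * (2 * r) ^+ n.+1).
      apply: le_trans (cmod_sum _ _ _) _.
      apply: (@le_trans _ _ (\sum_(n.+1 <= k < N) M * (2 * r) ^+ k)).
        apply: ler_sum => k _; rewrite cmodM cmodX cmod_real gtr0_norm // exprMn mulrA.
        by rewrite ler_wpM2r // exprn_ge0 // ltW.
      rewrite -mulr_sumr ler_wpM2l // geometric_tail_le //; apply/andP; split; lra.
    have := cmodB (d n * (r%:C)%C ^+ n + T) T; rewrite addrK cmodM cmodX cmod_real gtr0_norm //.
    move=> /le_trans; apply; by rewrite lerD2l.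
  rewrite cmod0 subr_le0 exprMn [r ^+ n.+1]exprS in H.
  rewrite -(ler_pM2r (exprn_gt0 n r0)) (le_trans H) //.
  by rewrite le_eqVlt; apply/orP; left; apply/eqP; ring.
apply/eqP; rewrite -cmod_eq0; apply/eqP/le_anti; rewrite cmod_ge0 andbT.
rewrite leNgt; apply/negP; set z := cmod (d n) => z0.
pose K := 2 * M * 2 ^+ n.+1.
have K0 : 0 <= K by rewrite !mulr_ge0 ?exprn_ge0.
pose r := Num.min 4^-1 (z / (2 * (K + 1))).
have r0 : 0 < r by rewrite lt_min divr_gt0 ?andbT ?invr_gt0 //; lra.
have /key : 0 < r <= 4^-1 by rewrite r0 ge_min lexx.
rewrite -/K -/z => h.
have : r * (2 * (K + 1)) <= z by rewrite -ler_pdivlMr ?ge_min ?lexx ?orbT //; lra.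
nra.
Unshelve. all: by end_near. Qed.

End PowerSeries.

(** * Lambert series as power series *)

(** The multiples of [d] below [S] are the [d m] with [m] below [S / d] rounded up. *)
Lemma sum_dilation (V : nmodType) (g : nat -> V) d S : (0 < d)%N ->
  \sum_(0 <= s < S) (if (d %| s)%N then g (s %/ d)%N else 0) =
  \sum_(0 <= m < (S + d.-1) %/ d) g m.
Proof.
move=> d0; elim: S => [|S IH].
  by rewrite big_nil add0n divn_small ?prednK // big_nil.
rewrite big_nat_recr //= IH; case: ifPn => dS.
  have -> : ((S.+1 + d.-1) %/ d = ((S + d.-1) %/ d).+1)%N.
    have -> : (S.+1 + d.-1 = S + d)%N by lia.
    case/dvdnP: dS => k ->.
    by rewrite divnMDl // divnn d0 divnMDl // divn_small ?prednK // addn0 addn1.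
  rewrite big_nat_recr //=; congr (_ + g _).
  by case/dvdnP: dS => k ->; rewrite mulnK // divnMDl // divn_small ?prednK // addn0.
rewrite addr0; congr (\sum_(0 <= m < _) _).
have -> : (S.+1 + d.-1 = S + d)%N by lia.
rewrite (divn_eq S d) -!addnA !divnMDl //; congr (_ + _)%N.
have r0 : (0 < S %% d)%N by rewrite lt0n.
have rd : (S %% d < d)%N by rewrite ltn_mod.
have -> : (S %% d + d.-1 = 1 * d + (S %% d).-1)%N by lia.
rewrite divnMDl // divnDr ?dvdnn // divnn d0 !divn_small //; lia.
Qed.

Section LambertPowerSeries.
Variable R : realType.
Local Notation C := (Cplx R).

Lemma series_dilation (g : nat -> C) (L : C) d : (0 < d)%N ->
  series g @ \oo --> L ->
  series (fun s => if (d %| s)%N then g (s %/ d)%N else 0) @ \oo --> L.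
Proof.
move=> d0 hg.
have h : forall m, \forall S \near \oo, (m <= (S + d.-1) %/ d)%N.
  move=> m; near=> S; rewrite leq_divRL //.
  have : (m * d <= S)%N by near: S; exact: nbhs_infty_ge.
  lia.
by apply: (cvg_ext (cvg_index h hg)) => S; rewrite /series /= sum_dilation.
Unshelve. all: by end_near. Qed.

(** Shifting the index by [p] multiplies the sum by [x ^ p], up to the initial term
    [x ^ v]. *)
Lemma series_residue_class (x : C) p v : cmod x < 1 -> (v < p)%N ->
  series (fun m => (m %% p == v)%N%:R * x ^+ m) @ \oo --> x ^+ v / (1 - x ^+ p).
Proof.
move=> x1 vp; have p0 : (0 < p)%N by exact: leq_ltn_trans vp.
have [T hT] : exists T : C, series (fun m => (m %% p == v)%N%:R * x ^+ m) @ \oo --> T.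
  apply: (@abs_series_cvg _ _ (fun m => 1 * (m%:R ^+ 0 * cmod x ^+ m))) => [m|].
    rewrite cmodM cmod_nat cmodX expr0 !mul1r ler_piMl ?exprn_ge0 ?cmod_ge0 //.
    by case: eqP.
  by apply: is_cvg_series_natX_geometric; rewrite cmod_ge0.
have h1 : (fun n => series (fun m => (m %% p == v)%N%:R * x ^+ m) (n + p)%N) @ \oo --> T.
  apply: (cvg_index _ hT) => m; near=> n.
  by rewrite (leq_trans _ (leq_addr _ _)) //; near: n; exact: nbhs_infty_ge.
have h2 := cvgsD (cvgs_cst (x ^+ v)) (cvgsMl hT (x ^+ p)).
have E : T = x ^+ v + x ^+ p * T.
  apply: cvg_uniq h1 _; apply: (cvg_ext h2) => n.
  rewrite /series /= addnC (big_cat_nat (leq0n p) (leq_addr n p)) /=; congr (_ + _).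
    rewrite big_mkord (bigD1 (Ordinal vp)) //= modn_small // eqxx mul1r.
    rewrite big1 ?addr0 // => i /eqP iv; rewrite modn_small //.
    by case: eqP => [e|]; [case: iv; exact: val_inj | rewrite mul0r].
  have -> (F : nat -> C) : \sum_(p <= i < p + n) F i = \sum_(0 <= i < n) F (i + p)%N.
    by rewrite -{1}[p]add0n big_addn addKn.
  rewrite mulr_sumr; apply: eq_bigr => i _.
  by rewrite modnDr exprD; ring.
have n0 : 1 - x ^+ p != 0 by rewrite -(prednK p0) Qpow_neq1.
have <- // : T = x ^+ v / (1 - x ^+ p).
by apply: (mulIf n0); rewrite divfK // mulrBr mulr1 {1}E; ring.
Unshelve. all: by end_near. Qed.

(** The coefficient of [q ^ s] in the double series [sum d ^ k chi(m) q ^ (d m)]. *)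
Definition lambert_coef (k : nat) (chi : nat -> C) (s : nat) : C :=
  \sum_(0 <= d < s.+1) (if (d %| s)%N then d%:R ^+ k * chi (s %/ d)%N else 0).

(** As [chi 0 = 0], the row of index [d] starts in degree [d]: the first [N] rows
    already give the coefficients of degree less than [N], and Tannery's theorem
    allows [N] to tend to infinity. *)
Lemma lambert_to_power_series (k : nat) (chi row : nat -> C) (q L : C) (B : R) :
  (0 < k)%N -> 0 <= B -> (forall m, cmod (chi m) <= B) -> chi 0%N = 0 -> cmod q < 1 ->
  (forall d, (0 < d)%N -> series (fun m => chi m * (q ^+ d) ^+ m) @ \oo --> row d) ->
  series (fun d => d%:R ^+ k * row d) @ \oo --> L ->
  series (fun s => lambert_coef k chi s * q ^+ s) @ \oo --> L.
Proof.
move=> k0 B0 hB chi0 q1 hrow hL.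
pose cN N s : C := \sum_(0 <= d < N) (if (d %| s)%N then d%:R ^+ k * chi (s %/ d)%N else 0).
have z0 : (0%:R ^+ k : C) = 0 by rewrite expr0n eqn0Ngt k0.
have cN_small N s : (s < N)%N -> cN N s = lambert_coef k chi s.
  move=> sN; rewrite /cN (big_cat_nat (leq0n s.+1) sN) /= [X in _ + X]big1_seq ?addr0 // => d.
  rewrite mem_index_iota /= => /andP[sd _]; case: ifP => // /dvdnP [m sE].
  case: m sE => [|m] sE; last by move: sd; rewrite sE; nia.
  by rewrite sE mul0n div0n chi0 mulr0.
have cN_bound N s : cmod (cN N s) <= B * (s.+1%:R * s%:R ^+ k).
  have le1 M : (M <= s.+1)%N -> cmod (cN M s) <= B * (s.+1%:R * s%:R ^+ k).
    move=> Ms; rewrite (le_trans (cmod_sum _ _ _)) //.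
    apply: (@le_trans _ _ (\sum_(0 <= d < M) B * s%:R ^+ k)).
      rewrite !big_nat; apply: ler_sum => d /andP[_ dM].
      case: ifP => _; last by rewrite cmod0 mulr_ge0 ?exprn_ge0.
      rewrite cmodM cmodX cmod_nat mulrC; apply: ler_pM; rewrite ?cmod_ge0 ?exprn_ge0 //.
      by rewrite lerXn2r ?nnegrE // ler_nat -ltnS (leq_trans dM).
    rewrite sumr_const_nat subn0 -[X in X <= _]mulr_natl mulrCA ler_wpM2l //.
    by rewrite ler_wpM2r ?exprn_ge0 // ler_nat.
  have [sN|Ns] := ltnP s N; last by apply: le1; exact: leqW.
  by rewrite cN_small // -(cN_small s.+1) //; exact: le1.
pose M s : R := B * (s.+1%:R * s%:R ^+ k) * cmod q ^+ s.
have cM : cvgn (series M).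
  have q01 : 0 <= cmod q < 1 by rewrite cmod_ge0.
  have -> : M = (fun s => B * (s%:R ^+ k.+1 * cmod q ^+ s)) \+ (fun s => B * (s%:R ^+ k * cmod q ^+ s)).
    by apply/funext => s; rewrite /M /= -natr1 exprS; ring.
  by apply: is_cvg_seriesD; exact: is_cvg_series_natX_geometric.
have dom N s : cmod (cN N s * q ^+ s) <= M s.
  by rewrite cmodM cmodX ler_wpM2r ?exprn_ge0 ?cmod_ge0.
have cc s : (fun N => cN N s * q ^+ s) @ \oo --> lambert_coef k chi s * q ^+ s.
  apply: (cvg_near_eq (cvgs_cst _)); near=> N; rewrite cN_small //.
  by near: N; exact: nbhs_infty_gt.
have [L' hL'] := dominated_limit_cvg dom cM cc.
have rows N : series (fun s => cN N s * q ^+ s) @ \oo --> series (fun d => d%:R ^+ k * row d) N.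
  have := @cvgs_sum R (fun d => series (fun s => (if (d %| s)%N then d%:R ^+ k * chi (s %/ d)%N else 0) * q ^+ s))
    (fun d => d%:R ^+ k * row d) N _.
  move=> h; apply: (cvg_ext (h _)) => [[|d]|S].
  - rewrite z0 mul0r; apply: (cvg_ext (cvgs_cst 0)) => S.
    by rewrite /series /= big1 // => s _; case: ifP; rewrite !mul0r.
  - have := series_dilation (ltn0Sn d) (hrow _ (ltn0Sn d)) => hd.
    apply: (cvg_ext (cvgsMl hd (d.+1%:R ^+ k))) => S.
    rewrite /series /= mulr_sumr; apply: eq_bigr => s _; case: ifP => ds; last by rewrite mulr0 mul0r.
    by rewrite -exprM mulnC divnK // mulrA.
  - rewrite /series /= exchange_big /=; apply: eq_bigr => s _.
    by rewrite /cN mulr_suml.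
have := tannery rows dom cM cc hL'; move=> hL2.
by rewrite (cvg_uniq hL hL2).
Unshelve. all: by end_near. Qed.

(** Only the divisors [d] with [p] not dividing [s / d] contribute, and for
    [s = p n] these are the [p d'] with [d'] dividing [n]. *)
Lemma lambert_coefM (k : nat) (chi : nat -> C) (p n : nat) : prime p -> (0 < k)%N ->
  (forall m, (p %| m)%N -> chi m = 0) ->
  lambert_coef k chi (p * n) = p%:R ^+ k * lambert_coef k chi n.
Proof.
move=> pp k0 chip; have p0 := prime_gt0 pp; rewrite /lambert_coef mulr_sumr.
pose g d' : C := p%:R ^+ k * (if (d' %| n)%N then d'%:R ^+ k * chi (n %/ d')%N else 0).
transitivity (\sum_(0 <= d < (p * n).+1) (if (p %| d)%N then g (d %/ p)%N else 0)); last first.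
  rewrite sum_dilation //; congr (\sum_(0 <= d < _) _).
  by rewrite addSnnS prednK // -mulnSr mulKn.
rewrite !big_nat; apply: eq_bigr => d /andP[_ dn].
case: (boolP (p %| d)%N) => [/dvdnP [d' ->]|pd].
  rewrite mulnK // /g mulnC dvdn_pmul2l // divnMl //.
  by case: ifP => _; rewrite ?mulr0 // natrM exprMn mulrA.
case: ifP => // /dvdnP [m mE].
have d0 : (0 < d)%N by rewrite lt0n; apply: contra pd => /eqP ->; rewrite dvdn0.
rewrite mE mulnK // chip ?mulr0 //.
have : (p %| m * d)%N by rewrite -mE dvdn_mulr.
by rewrite Euclid_dvdM // (negPf pd) orbF.
Qed.

(** A divisor [d] of [s] gives [s / d <= s < v]. *)
Lemma lambert_coef_small (k : nat) (chi : nat -> C) (v s : nat) : (0 < k)%N ->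
  (forall m, (m < v)%N -> chi m = 0) -> (s < v)%N -> lambert_coef k chi s = 0.
Proof.
move=> k0 chi0 sv; rewrite /lambert_coef big1 // => d _; case: ifP => // _.
by rewrite chi0 ?mulr0 // (leq_ltn_trans (leq_div _ _)).
Qed.

End LambertPowerSeries.

(** * Expansions in q *)

Section QExpansion.
Variable R : realType.
Local Notation C := (Cplx R).
Implicit Types tau : C.

Lemma cexpD (z w : C) : cexp (z + w) = cexp z * cexp w.
Proof.
case: z w => [a b] [c d]; rewrite /cexp /= expRD cosD sinD.
apply/eqP; rewrite eq_complex /=; apply/andP; split; apply/eqP; ring.
Qed.

Lemma cexpMn (z : C) n : cexp (z *+ n) = cexp z ^+ n.
Proof.
elim: n => [|n IH]; last by rewrite mulrS exprS cexpD IH.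
rewrite mulr0n expr0 /cexp /= expR0 cos0 sin0.
by apply/eqP; rewrite eq_complex /= !mul0r !mulr0 mul1r subr0 addr0 !eqxx.
Qed.

Lemma cmod_cexp (z : C) : cmod (cexp z) = expR (complex.Re z).
Proof.
rewrite /cexp cmodM cmod_real ger0_norm ?expR_ge0 // -[RHS]mulr1; congr (_ * _).
by rewrite /cmod /ComplexField.Normc.normc /= cos2Dsin2 sqrtr1.
Qed.

Lemma qvar_neq0 tau : qvar tau != 0.
Proof. by rewrite -cmod_gt0 /qvar cmod_cexp expR_gt0. Qed.

Lemma qvar_lt1 tau : upper_half_plane tau -> cmod (qvar tau) < 1.
Proof.
move=> tau_up; have {tau_up} : 0 < complex.Im tau by [].
rewrite /qvar cmod_cexp -expR0 ltr_expR; case: tau => a b /= b0.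
rewrite mul0r sub0r oppr_lt0.
by rewrite mulr_gt0 // mulr_gt0 // pi_gt0.
Qed.

Lemma qpow_nat tau n : qpow tau n%:R = qvar tau ^+ n.
Proof.
rewrite /qpow /qvar -cexpMn; congr (cexp _).
by rewrite ratr_nat mulrAC mulr_natr.
Qed.

Lemma qvar_surj (r : R) : 0 < r < 1 ->
  exists2 tau, upper_half_plane tau & qvar tau = (r%:C)%C.
Proof.
move=> /andP[r0 r1]; have pi20 : 0 < 2 * pi :> R by rewrite mulr_gt0 // pi_gt0.
exists (0 +i* (- ln r / (2 * pi)))%C.
  by rewrite /upper_half_plane /= divr_gt0 // oppr_gt0 ln_lt0 // r0.
have -> : qvar (0 +i* (- ln r / (2 * pi)))%C = cexp ((ln r)%:C%C : C).
  rewrite /qvar; congr (cexp _); have : pi != 0 :> R by rewrite gt_eqF // pi_gt0.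
  move: pi => P P0; apply/eqP; rewrite eq_complex /=; apply/andP; split; apply/eqP.
    by field.
  by ring.
rewrite /cexp /= lnK ?posrE // cos0 sin0.
by apply/eqP; rewrite eq_complex /= !mul0r !mulr0 mulr1 subr0 addr0 !eqxx.
Qed.

(** On the imaginary axis [q] takes every real value strictly between [0] and [1]. *)
Lemma is_qexpansion_uniq (f : C -> C) (b b' : nat -> C) :
  is_qexpansion f b -> is_qexpansion f b' -> b = b'.
Proof.
move=> hb hb'; apply/funext => n; apply/eqP; rewrite -subr_eq0; apply/eqP.
apply: (@power_series_eq0 R (fun n => b n - b' n)) => r hr.
have [tau tau_up <-] := qvar_surj hr.
have := cvgsB (hb _ tau_up) (hb' _ tau_up); rewrite subrr => h.
apply: (cvg_ext h) => N; rewrite /series /= -sumrB.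
by apply: eq_bigr => k _; rewrite mulrBl.
Qed.

Lemma qcoefE (f : C -> C) (b : nat -> C) : is_qexpansion f b -> qcoef f = b.
Proof.
move=> hb; apply: (is_qexpansion_uniq _ hb).
by rewrite /qcoef; apply: (@xgetPex _ _ [set b | is_qexpansion f b]); exists b.
Qed.

Lemma Up_eigen (p : nat) (f : C -> C) (b : nat -> C) (lam : C) tau :
  is_qexpansion f b -> (forall n, b (p * n)%N = lam * b n) ->
  upper_half_plane tau -> Up p f tau = lam * f tau.
Proof.
move=> hb hp htau; rewrite /Up (qcoefE hb).
have h : series (fun n => b (p * n)%N * qvar tau ^+ n) @ \oo --> lam * f tau.
  apply: (cvg_ext (cvgsMl (hb _ htau) lam)) => N.
  by rewrite /series /= mulr_sumr; apply: eq_bigr => n _; rewrite hp mulrA.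
exact: cvg_lim h.
Qed.

Section Expansions.
Variable p : nat.
Hypothesis p_prime : prime p.

Let p0 : (0 < p)%N. Proof. exact: prime_gt0. Qed.

(** The indicator of a residue class, and the combinations of such indicators that
    are the coefficients of the two Lambert series. They are supported away from
    the multiples of [p]. *)
Definition residue (v m : nat) : C := (m %% p == v)%N%:R.

Definition chi3 (v m : nat) : C := residue v m - residue (p - v) m.
Definition chi2 (v u m : nat) : C :=
  residue v m + residue (p - v) m - (residue u m + residue (p - u) m).

Lemma residue_bound v m : cmod (residue v m) <= 1.
Proof. by rewrite cmod_nat; case: eqP. Qed.

Lemma residue_small v m : (m < v < p)%N -> residue v m = 0.
Proof.
move=> /andP[mv vp]; rewrite /residue modn_small ?(ltn_trans mv) //.
by case: eqP => // e; rewrite e ltnn in mv.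
Qed.

Lemma residue_mult v m : (0 < v)%N -> (p %| m)%N -> residue v m = 0.
Proof. by move=> v0 /eqP h; rewrite /residue h; case: v v0. Qed.

Section AtTau.
Variable tau : C.
Hypothesis tau_up : upper_half_plane tau.
Let q := qvar tau.
Let Q := q ^+ p.

Let q0 : q != 0. Proof. exact: qvar_neq0. Qed.
Let q1 : cmod q < 1. Proof. exact: qvar_lt1. Qed.

Lemma nome_neq0 : Q != 0. Proof. exact: expf_neq0. Qed.

Lemma cmod_qpow_lt (m n : nat) : (m < n)%N -> cmod (q ^+ n) < cmod (q ^+ m).
Proof. by move=> mn; rewrite !cmodX ltr_iXn2l // cmod_gt0. Qed.

Lemma nome_lt1 : cmod Q < 1.
Proof. by have := cmod_qpow_lt p0; rewrite expr0 cmod1. Qed.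

Lemma annulus v : (0 < v < p)%N -> cmod Q < cmod (q ^+ v) < 1.
Proof.
move=> /andP[v0 vp]; rewrite cmod_qpow_lt //=.
by have := cmod_qpow_lt v0; rewrite expr0 cmod1.
Qed.

Let complement v : (v <= p)%N -> Q / q ^+ v = q ^+ (p - v).
Proof. by move=> vp; rewrite /Q -{1}(subnK vp) exprD mulfK ?expf_neq0. Qed.

Let row v d : (0 < d)%N -> (v < p)%N ->
  series (fun m => residue v m * (q ^+ d) ^+ m) @ \oo --> (q ^+ v) ^+ d / (1 - Q ^+ d).
Proof.
move=> d0 vp; have qd1 : cmod (q ^+ d) < 1 by rewrite cmodX exprn_ilt1 ?cmod_ge0 -?lt0n.
have := series_residue_class qd1 vp.
by rewrite /Q -!exprM (mulnC d v) (mulnC d p).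
Qed.

Lemma weight3_series v : (0 < v < p)%N ->
  series (fun s => lambert_coef 2 (chi3 v) s * q ^+ s) @ \oo -->
  q ^+ v * qpoch Q Q ^+ 6 * theta (q ^+ (v + v)) Q / theta (q ^+ v) Q ^+ 4.
Proof.
move=> hv; have /andP[v0 vp] := hv.
have h := weight3_identity nome_neq0 nome_lt1 (annulus hv).
have -> : q ^+ (v + v) = (q ^+ v) ^+ 2 by rewrite exprD expr2.
apply: (@lambert_to_power_series R 2 (chi3 v)
  (fun d => ((q ^+ v) ^+ d - (Q / q ^+ v) ^+ d) / (1 - Q ^+ d)) q _ (1 + 1) _ _ _ _ q1 _ h).
- by [].
- by [].
- by move=> m; rewrite (le_trans (cmodB _ _)) // lerD ?residue_bound.
- by rewrite /chi3 !residue_mult ?subrr // subn_gt0.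
move=> d d0; rewrite (complement (ltnW vp)).
have pv : (p - v < p)%N by lia.
have := cvgsB (row d0 vp) (row d0 pv); rewrite -mulrBl => h1.
apply: (cvg_ext h1) => N; rewrite /series /= -sumrB.
by apply: eq_bigr => m _; rewrite /chi3 mulrBl.
Qed.

Lemma weight2_series v u : (0 < v < p)%N -> (0 < u < p)%N -> (v <= u)%N ->
  series (fun s => lambert_coef 1 (chi2 v u) s * q ^+ s) @ \oo -->
  q ^+ v * qpoch Q Q ^+ 4 * theta (q ^+ (u + v)) Q * theta (q ^+ (u - v)) Q
    / (theta (q ^+ v) Q ^+ 2 * theta (q ^+ u) Q ^+ 2).
Proof.
move=> hv hu vu; have /andP[v0 vp] := hv; have /andP[u0 up] := hu.
have h := weight2_identity nome_neq0 nome_lt1 (annulus hv) (annulus hu).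
have -> : q ^+ (u + v) = q ^+ v * q ^+ u by rewrite mulrC exprD.
have -> : q ^+ (u - v) = q ^+ u / q ^+ v by rewrite -{2}(subnK vu) exprD mulfK ?expf_neq0.
apply: (@lambert_to_power_series R 1 (chi2 v u)
  (fun d => lambert_weight Q (q ^+ v) d - lambert_weight Q (q ^+ u) d) q _ (1 + 1 + (1 + 1)) _ _ _ _ q1 _ h).
- by [].
- by [].
- by move=> m; rewrite (le_trans (cmodB _ _)) // lerD // (le_trans (cmodD _ _)) // lerD ?residue_bound.
- by rewrite /chi2 !residue_mult ?subrr // subn_gt0.
move=> d d0; rewrite /lambert_weight (complement (ltnW vp)) (complement (ltnW up)).
have pv : (p - v < p)%N by lia.
have pu : (p - u < p)%N by lia.
have := cvgsB (cvgsD (row d0 vp) (row d0 pv)) (cvgsD (row d0 up) (row d0 pu)).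
rewrite -!mulrDl => h1.
apply: (cvg_ext h1) => N; rewrite /series /= -!big_split -sumrB.
by apply: eq_bigr => m _; rewrite /chi2 mulrBl !mulrDl.
Qed.

End AtTau.
End Expansions.
End QExpansion.

(** * Exponent vectors attached to a pair of residues *)

Section EtaQuotients.
Variable p : nat.
Hypothesis p_prime : prime p.
Hypothesis p_gt2 : (2 < p)%N.
Local Notation h := (halfp p).

Lemma double_halfp : p = (h.*2).+1.
Proof.
have op : odd p by have [] := even_prime p_prime; lia.
rewrite /halfp; lia.
Qed.

(** The exponents of the theta products in the identities of weight 2 ([v < u]) and
    3 ([u = v]). In the second case [u - v] is [0], which is not the index of a
    theta product, and the corresponding term disappears. *)
Definition exponents (u v i : nat) : int :=
  (i == repr_pm1 p (u + v))%:Z + (i == u - v)%N%:Z - 2 * (i == u)%:Z - 2 * (i == v)%:Z.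

Lemma repr_pm1_small m : (m < p)%N -> repr_pm1 p m = minn m (p - m).
Proof. by move=> mp; rewrite /repr_pm1 modn_small. Qed.

Lemma sum_indicator (V : zmodType) (F : nat -> V) r : (r <= h)%N -> F 0%N = 0 ->
  \sum_(1 <= i < h.+1) F i *~ (i == r)%:Z = F r.
Proof.
case: r => [|r] rh F0.
  by rewrite F0 big_nat big1 // => i /andP[i0 _]; case: i i0.
rewrite (bigD1_seq r.+1) ?iota_uniq ?mem_index_iota //= eqxx big1 ?addr0 //.
by move=> i /negPf ->.
Qed.

Lemma sum_exponents (V : zmodType) (F : nat -> V) u v :
  (v <= u <= h)%N -> F 0%N = 0 ->
  \sum_(1 <= i < h.+1) F i *~ exponents u v i =
  F (repr_pm1 p (u + v)) + F (u - v)%N - F u *+ 2 - F v *+ 2.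
Proof.
move=> /andP[vu uh] F0; have p2 := double_halfp.
have rh : (repr_pm1 p (u + v) <= h)%N by rewrite repr_pm1_small; lia.
rewrite -(sum_indicator rh F0) -(sum_indicator (r := u - v) _ F0); last by lia.
rewrite -(sum_indicator uh F0) -(sum_indicator (leq_trans vu uh) F0).
rewrite -!sumrMnl -!sumrN -!big_split /=; apply: eq_bigr => i _.
rewrite /exponents !mulrzBr mulrzDr; congr (_ - _ - _).
all: by rewrite mulrC mulrzA -pmulrn.
Qed.

Lemma prod_exponents (K : fieldType) (x : nat -> K) u v :
  (0 < v)%N -> (v <= u <= h)%N -> x 0%N = 1 -> (forall i, (i <= h)%N -> x i != 0) ->
  \prod_(1 <= i < h.+1) x i ^ exponents u v i =
  x (repr_pm1 p (u + v)) * x (u - v)%N / (x u ^+ 2 * x v ^+ 2).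
Proof.
move=> v0 /andP[vu uh] x0 nz; have p2 := double_halfp.
have ind r : (r <= h)%N -> \prod_(1 <= i < h.+1) x i ^ (i == r)%:Z = x r.
  case: r => [|r] rh.
    by rewrite x0 big_nat big1 // => i /andP[i0 _]; case: i i0.
  rewrite (bigD1_seq r.+1) ?iota_uniq ?mem_index_iota //= eqxx big1 ?mulr1 //.
  by move=> i /negPf ->.
have rh : (repr_pm1 p (u + v) <= h)%N by rewrite repr_pm1_small; lia.
rewrite -(ind _ rh) -(ind (u - v)%N); last by lia.
rewrite -(ind _ uh) -(ind _ (leq_trans vu uh)).
rewrite -!prodrXl -!big_split -prodfV -!big_split /= !big_nat; apply: eq_bigr => i /andP[_ ih].
have xi := nz i ih.
rewrite /exponents !expfzDr // invfM mulrA; congr (_ * _ * _ * _).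
  by case: (i == u); rewrite ?expr1z // mulr0 oppr0 !expr0z expr1n invr1.
by case: (i == v); rewrite ?expr1z // mulr0 oppr0 !expr0z expr1n invr1.
Qed.

Lemma fracpart_small i : (i < p)%N -> fracpart (i%:R / p%:R) = i%:R / p%:R :> rat.
Proof.
move=> ip; rewrite /fracpart (_ : Num.floor _ = 0) ?subr0 //.
apply: floor_def; rewrite divr_ge0 ?ler0n //= add0r ltr_pdivrMr ?ltr0n ?mul1r ?ltr_nat //.
exact: leq_ltn_trans ip.
Qed.

(** The first part of [ell] vanishes, as [b_0 + 2 (b_1 + ... + b_h) = 0]. In the
    second one [phi(i) = i (p - i)] gives
    [2 phi(u) + 2 phi(v) - phi(u + v) - phi(u - v) = 2 p v],
    the quadratic terms cancelling by the parallelogram law. *)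
Lemma ell_exponents (b : seq int) u v : (0 < v)%N -> (v <= u <= h)%N ->
  b`_0 = (if u == v then 6 else 4) ->
  (forall i, (0 < i <= h)%N -> b`_i = exponents u v i) ->
  ell p b = v%:R.
Proof.
move=> v0 vuh b0 hb; have p2 := double_halfp; have /andP[vu uh] := vuh.
have pn0 : p%:R != 0 :> rat by rewrite pnatr_eq0; lia.
rewrite /ell.
have -> : \sum_(1 <= i < h.+1) b`_i = (if u == v then -3 else -2).
  pose F i : int := (0 < i)%N%:Z.
  have -> : \sum_(1 <= i < h.+1) b`_i = \sum_(1 <= i < h.+1) F i *~ exponents u v i.
    rewrite !big_nat; apply: eq_bigr => i /andP[i0 ih].
    by rewrite hb ?i0 // /F i0 /= intz.
  rewrite sum_exponents // /F subn_gt0 v0 (leq_trans v0 vu).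
  have -> : (0 < repr_pm1 p (u + v))%N by rewrite repr_pm1_small; lia.
  by move: vu; case: (ltngtP u v).
have -> : (b`_0 + 2 * (if u == v then -3 else -2) = 0)%R by rewrite b0; case: eqP.
rewrite mulr0 sub0r.
pose F i : rat := i%:R / p%:R * (1 - i%:R / p%:R).
have -> : \sum_(1 <= i < h.+1) fracpart (i%:R / p%:R) * (1 - fracpart (i%:R / p%:R)) * (b`_i)%:~R =
    \sum_(1 <= i < h.+1) F i *~ exponents u v i.
  rewrite !big_nat; apply: eq_bigr => i /andP[i0 ih].
  by rewrite hb ?i0 // fracpart_small ?mulrzr //; lia.
rewrite sum_exponents //; last by rewrite /F mul0r mul0r.
have -> : F (repr_pm1 p (u + v)) = F (u + v)%N.
  rewrite repr_pm1_small; last by lia.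
  case: leqP => // h1; rewrite /F natrB; last by lia.
  by field.
rewrite /F natrB // natrD; field.
exact: pn0.
Qed.

End EtaQuotients.

(** * Expansion of the eta quotients *)

Section EtaQuotientExpansion.
Variables (R : realType) (p : nat).
Local Notation C := (Cplx R).
Hypothesis p_prime : prime p.
Hypothesis p_gt2 : (2 < p)%N.
Local Notation h := (halfp p).

Section AtTau.
Variable tau : C.
Hypothesis tau_up : upper_half_plane tau.
Let q := qvar tau.
Let Q := q ^+ p.
Let q0 : q != 0. Proof. exact: qvar_neq0. Qed.

Let theta_qpoch2 i : (i <= p)%N -> theta (q ^+ i) Q = qpoch2 (q ^+ i) (q ^+ (p - i)) Q.
Proof.
by move=> ip; rewrite /theta /Q -[in q ^+ p](subnK ip) exprD mulfK ?expf_neq0.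
Qed.

Let theta_reflect i : (i <= p)%N -> theta (q ^+ (p - i)) Q = theta (q ^+ i) Q.
Proof.
by move=> ip; rewrite !theta_qpoch2 ?leq_subr // subKn // /qpoch2 mulrC.
Qed.

Let theta_nz i : (0 < i < p)%N -> theta (q ^+ i) Q != 0.
Proof.
move=> hi; apply: theta_neq0; first exact: nome_lt1.
exact: (generic_annulus (nome_lt1 p_prime tau_up) (annulus tau_up hi)).
Qed.

Lemma feta_theta (b : seq int) u v : (0 < v)%N -> (v <= u <= h)%N ->
  (forall i, (0 < i <= h)%N -> b`_i = exponents p u v i) ->
  feta p b tau = qpow tau (ell p b) * qpoch Q Q ^ b`_0 *
   (theta (q ^+ (u + v)) Q * (if u == v then 1 else theta (q ^+ (u - v)) Q)
     / (theta (q ^+ u) Q ^+ 2 * theta (q ^+ v) Q ^+ 2)).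
Proof.
move=> v0 vuh hb; have p2 := double_halfp p_prime p_gt2; have /andP[vu uh] := vuh.
rewrite /feta -/q -/Q; congr (_ * _).
pose x i : C := if i == 0%N then 1 else theta (q ^+ i) Q.
have -> : \prod_(1 <= i < h.+1) qpoch2 (q ^+ i) (q ^+ (p - i)) Q ^ b`_i =
    \prod_(1 <= i < h.+1) x i ^ exponents p u v i.
  rewrite !big_nat; apply: eq_bigr => i /andP[i0 ih].
  rewrite hb ?i0 // -theta_qpoch2; last by lia.
  by rewrite /x gtn_eqF.
rewrite prod_exponents //; last first.
  by case=> [|i] ih; [exact: oner_neq0 | rewrite /x /=; apply: theta_nz; lia].
have u0 : (0 < u)%N := leq_trans v0 vu.
have -> : x (repr_pm1 p (u + v)) = theta (q ^+ (u + v)) Q.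
  rewrite repr_pm1_small /x; last by lia.
  case: leqP => huv; rewrite gtn_eqF; try lia; first by [].
  by rewrite theta_reflect //; lia.
rewrite /x subn_eq0 (gtn_eqF u0) (gtn_eqF v0).
have -> // : (u <= v)%N = (u == v) by lia.
Qed.

End AtTau.

(** One less than the weight: the exponent of [p] in the eigenvalue of [U_p]. *)
Definition eigen_exponent (u v : nat) : nat := if u == v then 2 else 1.

(** The eta quotient is a Lambert series whose coefficients [chi(m)] vanish when [p]
    divides [m] and when [m < v]: hence the eigenvalue of [U_p] and the order of
    vanishing. *)
Theorem feta_lambert (b : seq int) u v : (0 < v)%N -> (v <= u <= h)%N ->
  b`_0 = (if u == v then 6 else 4) ->
  (forall i, (0 < i <= h)%N -> b`_i = exponents p u v i) ->
  exists c : nat -> C, [/\ is_qexpansion (@feta R p b) c,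
    forall n, c (p * n)%N = p%:R ^+ eigen_exponent u v * c n
    & forall s, (s < v)%N -> c s = 0].
Proof.
move=> v0 vuh b0 hb; have p2 := double_halfp p_prime p_gt2; have /andP[vu uh] := vuh.
have ellE := ell_exponents p_prime p_gt2 v0 vuh b0 hb.
have hv : (0 < v < p)%N by lia.
have hu : (0 < u < p)%N by lia.
have small w m : (m < v)%N -> (v <= w <= h)%N -> residue R p w m = 0 /\ residue R p (p - w) m = 0.
  move=> mv /andP[vw wh]; split; apply: residue_small; lia.
have mult w m : (p %| m)%N -> (0 < w < p)%N -> residue R p w m = 0 /\ residue R p (p - w) m = 0.
  move=> pm /andP[w0 wp]; split; apply: residue_mult => //; lia.
case: (eqVneq u v) b0 => [uv|uv] b0.
  exists (lambert_coef 2 (chi3 R p v)); split=> [tau tau_up|n|s sv].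
  - rewrite (feta_theta tau_up v0 vuh hb) ellE qpow_nat b0 uv eqxx.
    apply: (cvg_eq_lim (weight3_series p_prime tau_up hv)).
    by rewrite -exprD mulr1 !mulrA.
  - rewrite /eigen_exponent uv eqxx; apply: lambert_coefM => // m pm.
    by rewrite /chi3; have [-> ->] := mult v m pm hv; rewrite subrr.
  - apply: lambert_coef_small sv => // m mv.
    by rewrite /chi3; have [|-> ->] := small v m mv; [rewrite leqnn; lia | rewrite subrr].
exists (lambert_coef 1 (chi2 R p v u)); split=> [tau tau_up|n|s sv].
- rewrite (feta_theta tau_up v0 vuh hb) ellE qpow_nat b0 (negPf uv).
  apply: (cvg_eq_lim (weight2_series p_prime tau_up hv hu vu)).
  by rewrite [theta (_ ^+ v) _ ^+ 2 * _]mulrC !mulrA.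
- rewrite /eigen_exponent (negPf uv); apply: lambert_coefM => // m pm.
  by rewrite /chi2; have [-> ->] := mult v m pm hv; have [-> ->] := mult u m pm hu; rewrite subrr.
- apply: lambert_coef_small sv => // m mv.
  have [|e1 e2] := small v m mv; first by rewrite leqnn (leq_trans vu).
  have [|e3 e4] := small u m mv; first by rewrite vu.
  by rewrite /chi2 e1 e2 e3 e4 subrr.
Qed.

End EtaQuotientExpansion.

(** * The permutation sigma *)

Section Permutation.
Variable p : nat.
Hypothesis p_prime : prime p.
Hypothesis p_gt2 : (2 < p)%N.
Local Notation h := (halfp p).
Local Notation repr := (repr_pm1 p).

Let p2 : p = (h.*2).+1. Proof. exact: double_halfp. Qed.
Let p0 : (0 < p)%N. Proof. exact: prime_gt0. Qed.

Lemma repr_mod a b : a = b %[mod p] -> repr a = repr b.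
Proof. by rewrite /repr_pm1 => ->. Qed.

Lemma repr_opp a b : (p %| a + b)%N -> repr a = repr b.
Proof.
move=> /dvdnP [k kE]; rewrite /repr_pm1.
have := ltn_pmod a p0; have := ltn_pmod b p0.
have := divn_eq a p; have := divn_eq b p.
move: (a %/ p)%N (b %/ p)%N (a %% p)%N (b %% p)%N => x y r s hb ha sp rp.
have : (r + s = (k - x - y) * p)%N by nia.
case: (k - x - y)%N => [|[|z]] E; [lia|lia|nia].
Qed.

Lemma repr_cases m : (repr m = m %[mod p]) \/ (p %| repr m + m)%N.
Proof.
case: (boolP (p %| m)%N) => pm; last by have [] := repr_pm1P p_prime p_gt2 pm.
by left; rewrite /repr_pm1 (eqP pm) min0n mod0n.
Qed.

Lemma repr_mul x y : repr (x * repr y) = repr (x * y).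
Proof.
case: (repr_cases y) => hy; first by apply: repr_mod; rewrite -modnMmr hy modnMmr.
by apply: repr_opp; rewrite -mulnDr dvdn_mull.
Qed.

Lemma repr_id m : (m <= h)%N -> repr m = m.
Proof. by move=> mh; rewrite repr_pm1_small; lia. Qed.

Lemma repr_eq0 m : (repr m == 0%N) = (p %| m)%N.
Proof.
rewrite /repr_pm1 /dvdn; have := ltn_pmod m p0.
by move: (m %% p)%N => r rp; apply/eqP/eqP; lia.
Qed.

Lemma repr_range m : ~~ (p %| m)%N -> (0 < repr m <= h)%N.
Proof. by move=> pm; have [] := repr_pm1P p_prime p_gt2 pm. Qed.

Local Notation al := (alpha p).

Lemma alpha_generates : generates_mod_pm1 p al.
Proof. by rewrite /alpha; case: ex_minnP => m /andP[]. Qed.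

Lemma Fp_nat_eq0 m : (m%:R == 0 :> 'F_p) = (p %| m)%N.
Proof. by rewrite (dvdn_pcharf (pchar_Fp p_prime)). Qed.

(** The class of [alpha] generates the units modulo [1] and [-1]. *)
Lemma alpha_powers m : ~~ (p %| m)%N -> exists k, repr m = repr (al ^ k).
Proof.
move=> pm; have /existsP [u /andP[/eqP ua /eqP gen]] := alpha_generates.
have mu : (m%:R : 'F_p) \is a GRing.unit by rewrite unitfE Fp_nat_eq0.
pose x : {unit 'F_p} := FinRing.unit 'F_p mu.
have abG : abelian [set: {unit 'F_p}]%SET.
  by apply: cyclic_abelian; exact: field_unit_group_cyclic.
have nN (y : {unit 'F_p}) : y \in ('N(<[minus1 p]>))%g.
  exact: (fintype.subsetP (sub_abelian_norm abG (finset.subsetT _)) _ (finset.in_setT y)).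
have : coset <[minus1 p]> x \in ([set: {unit 'F_p}]%SET / <[minus1 p]>)%g.
  by rewrite mem_quotient ?finset.in_setT.
rewrite gen => /cycleP [k]; rewrite -morphX ?nN // => xu.
have [_ /cycleP [e ->] E] := kercoset_rcoset (nN _) (nN _) xu; exists k.
have E' : m%:R = (-1) ^+ e * (al ^ k)%:R :> 'F_p.
  have := congr1 val E; rewrite /= => ->.
  by rewrite !FinRing.val_unitX /= ua natrX.
case: (boolP (odd e)) => oe; move: E'; rewrite -signr_odd ?oe ?(negPf oe) ?expr0 ?expr1 ?mul1r ?mulN1r => E'.
  apply: repr_opp; rewrite -Fp_nat_eq0 natrD E'; by rewrite addNr.
by apply: repr_mod; have := congr1 val E'; rewrite /= !val_Fp_nat.
Qed.

Lemma alpha_ndvd : ~~ (p %| al)%N.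
Proof.
have /existsP [u /andP[/eqP ua _]] := alpha_generates.
by rewrite -Fp_nat_eq0 -ua -unitfE; exact: valP u.
Qed.

Lemma alpha_halfp : repr (al ^ h) = 1%N.
Proof.
have h0 : (0 < h)%N by lia.
rewrite -[RHS](repr_id h0).
have a0 : (al%:R : 'F_p) != 0 by rewrite Fp_nat_eq0 alpha_ndvd.
have : (al%:R : 'F_p) ^+ h.*2.+1 = al%:R.
  by rewrite -natrX -p2 -(Fp_nat_mod p_prime (al ^ p)) fermat_little // Fp_nat_mod.
rewrite exprS -[RHS]mulr1 => /(mulfI a0) /eqP.
rewrite -muln2 exprM sqrf_eq1 -natrX => /orP[] /eqP e.
  have e1 : (al ^ h)%:R = 1%:R :> 'F_p by rewrite e.
  by apply: repr_mod; have := congr1 (@nat_of_ord _) e1; rewrite !val_Fp_nat.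
by apply: repr_opp; rewrite -Fp_nat_eq0 natrD e addNr.
Qed.

Lemma alpha_pow_modn k : repr (al ^ k) = repr (al ^ (k %% h)).
Proof.
rewrite {1}(divn_eq k h); elim: (k %/ h)%N => [|c IH]; first by rewrite mul0n add0n.
by rewrite mulSn -addnA expnD mulnC -repr_mul alpha_halfp muln1.
Qed.

(** Multiplication by [alpha] carries each entry of the cycle to the following one,
    and the last entry to the first by [alpha_halfp]. *)
Lemma sigma_repr m : ~~ (p %| m)%N -> sigma p (repr m) = repr (al * m).
Proof.
move=> pm; have h0 : (0 < h)%N by lia.
rewrite /sigma; set s := map _ _.
have cs : path.cycle [rel x y | y == repr (al * x)] s.
  have -> : s = repr 1 :: [seq repr (al ^ k) | k <- iota 1 h.-1].
    by rewrite /s -{1}(prednK h0) /= expn0.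
  have pth n i : path [rel x y | y == repr (al * x)] (repr (al ^ i)) [seq repr (al ^ k) | k <- iota i.+1 n].
    elim: n i => //= n IH i; rewrite IH andbT.
    by rewrite repr_mul expnS.
  have lst n i : last (repr (al ^ i)) [seq repr (al ^ k) | k <- iota i.+1 n] = repr (al ^ (i + n)).
    by elim: n i => [|n IH] i /=; rewrite ?addn0 // IH addSnnS.
  have := pth h.-1 0%N; have := lst h.-1 0%N; rewrite expn0 add0n /= rcons_path => -> ->.
  by rewrite /= repr_mul -expnS prednK // alpha_halfp (repr_id h0).
have ms : repr m \in s.
  have [k ->] := alpha_powers pm; rewrite alpha_pow_modn; apply: map_f.
  by rewrite mem_iota /= add0n ltn_mod.
by have /eqP := next_cycle cs ms; rewrite repr_mul.
Qed.

Lemma iter_sigma_repr j m : ~~ (p %| m)%N -> iter j (sigma p) (repr m) = repr (al ^ j * m).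
Proof.
move=> pm; elim: j => [|j IH]; first by rewrite mul1n.
rewrite iterS IH sigma_repr ?expnS ?mulnA //.
by rewrite Euclid_dvdM // Euclid_dvdX // (negPf alpha_ndvd) (negPf pm).
Qed.

Lemma nth0_sigma_pow (a : seq int) j : (sigma_pow p j a)`_0 = a`_0.
Proof. by elim: j. Qed.

Lemma nth_sigma_pow (a : seq int) j i : (0 < i <= h)%N ->
  (sigma_pow p j a)`_i = a`_(iter j (sigma p) i).
Proof.
elim: j i => [//|j IH] [|i] // /andP[_ ih].
rewrite /sigma_pow iterS -/(sigma_pow p j a) /sigma_act /=.
rewrite (nth_map 0%N) ?size_iota // nth_iota // add1n.
have pi : ~~ (p %| i.+1)%N by apply/negP => /dvdn_leq; lia.
have si : sigma p i.+1 = repr (al * i.+1) by rewrite -{1}(repr_id ih) sigma_repr.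
rewrite IH; first by rewrite -iterS iterSr.
by rewrite si repr_range // Euclid_dvdM // (negPf alpha_ndvd).
Qed.

(** The permutation acts as multiplication by [alpha], and [beta] is inverse to
    [alpha ^ j] up to sign. *)
Lemma sigma_pow_inverse j : exists2 beta, ~~ (p %| beta)%N &
  forall i r, (0 < i <= h)%N -> (r <= h)%N ->
    (iter j (sigma p) i == r) = (i == repr (beta * r)).
Proof.
have pj : ~~ (p %| al ^ j)%N by rewrite Euclid_dvdX // (negPf alpha_ndvd).
(* [alpha ^ h] is [1] or [-1] *)
exists (al ^ (h.-1 * j))%N; first by rewrite Euclid_dvdX // (negPf alpha_ndvd).
have h0 : (0 < h)%N by lia.
have inv x : repr (al ^ (h.-1 * j) * (al ^ j * x)) = repr x.
  rewrite mulnA -expnD -mulSnr prednK // mulnC -repr_mul alpha_pow_modn modnMr.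
  by rewrite expn0 (repr_id h0) muln1.
move=> i r /andP[i0 ih] rh.
have pi : ~~ (p %| i)%N by apply/negP => /dvdn_leq; lia.
rewrite -{1}(repr_id ih) iter_sigma_repr //; apply/eqP/eqP => [<-|->].
  by rewrite repr_mul inv repr_id.
by rewrite repr_mul mulnCA inv repr_id.
Qed.

(** Up to signs, [beta u] and [beta v] are two residues [m] and [n] of the same
    range. If the two signs agree then [beta (u + v)] and [beta (u - v)] are
    [m + n] and [m - n] up to sign; otherwise they are exchanged. The exponents
    are invariant under this exchange and under that of [m] and [n]. *)
Lemma exponents_scale beta u v : ~~ (p %| beta)%N -> (0 < v)%N -> (v <= u <= h)%N ->
  exists u' v', [/\ (0 < v')%N, (v' <= u' <= h)%N, (u' == v') = (u == v) &
    forall i, (0 < i <= h)%N ->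
      (i == repr (beta * repr (u + v)))%:Z + (i == repr (beta * (u - v)))%:Z
        - 2 * (i == repr (beta * u))%:Z - 2 * (i == repr (beta * v))%:Z =
      exponents p u' v' i].
Proof.
move=> pb v0 /andP[vu uh].
pose m := repr (beta * u); pose n := repr (beta * v).
have range w : (0 < w <= h)%N -> (0 < repr (beta * w) <= h)%N.
  move=> /andP[w0 wh]; apply: repr_range; rewrite Euclid_dvdM // (negPf pb) /=.
  by apply/negP => /dvdn_leq; lia.
have /andP[m0 mh] : (0 < m <= h)%N by apply: range; lia.
have /andP[n0 nh] : (0 < n <= h)%N by apply: range; lia.
have repz (a b : nat) (s k : int) : s ^+ 2 = 1 -> a%:Z = s * b%:Z + k * p%:Z -> repr a = repr b.
  move=> /eqP; rewrite sqrf_eq1 => /orP[] /eqP -> E.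
    apply: repr_mod; apply/eqP; rewrite -eqz_nat -!modz_nat eqz_mod_dvd; apply/dvdzP.
    by exists k; rewrite E; ring.
  apply: repr_opp; have : (p%:Z %| (a + b)%:Z)%Z; last by [].
  by apply/dvdzP; exists k; rewrite PoszD E; ring.
have sgn x : exists s k : int, s ^+ 2 = 1 /\ (repr x)%:Z = s * x%:Z + k * p%:Z.
  case: (repr_cases x) => [/eqP|hx].
    rewrite -eqz_nat -!modz_nat eqz_mod_dvd => /dvdzP [k E].
    by exists 1, k; rewrite expr1n -E; split=> //; ring.
  have /dvdzP [k E] : (p%:Z %| (repr x + x)%:Z)%Z by exact: hx.
  by exists (-1), k; rewrite sqrrN expr1n -E PoszD; split=> //; ring.
have [s1 [k1 [hs1 E1]]] := sgn (beta * u)%N.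
have [s2 [k2 [hs2 E2]]] := sgn (beta * v)%N.
rewrite -/m in E1; rewrite -/n in E2.
pose D := (maxn m n - minn m n)%N.
have [t [ht ED]] : exists t : int, t ^+ 2 = 1 /\ D%:Z = t * (m%:Z - n%:Z).
  rewrite /D; case: (leqP m n) => hmn; [exists (-1)|exists 1]; split=> //; lia.
have Dh : (D <= h)%N by rewrite /D; lia.
have Es : (m + n)%:Z = s1 * (beta * u)%:Z + s2 * (beta * v)%:Z + (k1 + k2) * p%:Z.
  by rewrite PoszD E1 E2; ring.
have Ed : D%:Z = t * s1 * (beta * u)%:Z - t * s2 * (beta * v)%:Z + t * (k1 - k2) * p%:Z.
  by rewrite ED E1 E2; ring.
have Bs : (beta * (u + v))%:Z = (beta * u)%:Z + (beta * v)%:Z by rewrite mulnDr.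
have Bd : (beta * (u - v))%:Z = (beta * u)%:Z - (beta * v)%:Z.
  by rewrite mulnBr -subzn // leq_mul2l vu orbT.
have hts s : s ^+ 2 = 1 -> (t * s) ^+ 2 = 1 by move=> hs; rewrite exprMn ht hs.
have pair : (repr (beta * (u + v)) = repr (m + n) /\ repr (beta * (u - v)) = D) \/
            (repr (beta * (u + v)) = D /\ repr (beta * (u - v)) = repr (m + n)).
  have : s2 = s1 \/ s2 = - s1.
    by have /eqP := etrans hs2 (esym hs1); rewrite eqf_sqr => /orP[] /eqP ->; [left|right].
  rewrite -(repr_id Dh); case=> e; [left|right]; split; symmetry.
  - by apply: (repz _ _ s1 (k1 + k2)) => //; rewrite Es Bs e; ring.
  - by apply: (repz _ _ (t * s1) (t * (k1 - k2))); rewrite ?hts // Ed Bd e; ring.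
  - by apply: (repz _ _ (t * s1) (t * (k1 - k2))); rewrite ?hts // Ed Bs e; ring.
  - by apply: (repz _ _ s1 (k1 + k2)) => //; rewrite Es Bd e; ring.
have mn_eq : (m == n) = (u == v).
  apply/eqP/eqP => [mn|uv]; last by rewrite /m /n uv.
  have D0 : D = 0%N by rewrite /D mn maxnn minnn subnn.
  have zero w : repr (beta * w) = D -> (w < p)%N -> w = 0%N.
    rewrite D0 => /eqP; rewrite repr_eq0 Euclid_dvdM // (negPf pb) /=.
    by case: w => // w /dvdn_leq -/(_ isT) wp; rewrite ltnNge wp.
  case: pair => [[_ /zero uv]|[/zero uv _]]; first by have := uv _; lia.
  by have := uv _; lia.
exists (maxn m n), (minn m n); split.
- by rewrite leq_min m0.
- by rewrite (leq_trans (geq_minl m n) (leq_maxl m n)) geq_max mh.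
- by rewrite -mn_eq /maxn /minn; case: (m < n)%N; rewrite // eq_sym.
move=> i hi; rewrite /exponents repr_mul -/m -/n -/D.
have -> : (maxn m n + minn m n = m + n)%N.
  by rewrite addnC addn_min_max.
have mm : (i == maxn m n)%:Z + (i == minn m n)%:Z = (i == m)%:Z + (i == n)%:Z.
  by rewrite /maxn /minn; case: (m < n)%N; rewrite // addrC.
have -> x : x - 2 * (i == maxn m n)%:Z - 2 * (i == minn m n)%:Z = x - 2 * ((i == maxn m n)%:Z + (i == minn m n)%:Z).
  ring.
rewrite mm; case: pair => [[-> ->]|[-> ->]]; ring.
Qed.

End Permutation.

(** * Eigenforms *)

Section EigenForms.
Variables (R : realType) (p : nat).
Hypothesis p_prime : prime p.
Hypothesis p_gt2 : (2 < p)%N.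
Local Notation h := (halfp p).

Lemma sigma_pow_exponents (a : seq int) u v j : (0 < v)%N -> (v <= u <= h)%N ->
  (forall i, (0 < i <= h)%N -> a`_i = exponents p u v i) ->
  exists u' v', [/\ (0 < v')%N, (v' <= u' <= h)%N, (u' == v') = (u == v) &
    forall i, (0 < i <= h)%N -> (sigma_pow p j a)`_i = exponents p u' v' i].
Proof.
move=> v0 vuh ha; have p2 := double_halfp p_prime p_gt2.
have [beta pb hb] := sigma_pow_inverse p_prime p_gt2 j.
have [u' [v' [v'0 vuh' uv' he]]] := exponents_scale p_prime p_gt2 pb v0 vuh.
exists u', v'; split=> // i hi; rewrite nth_sigma_pow // -he //.
have /andP[vu uh] := vuh; have /andP[_ ih] := hi.
have rh : (repr_pm1 p (u + v) <= h)%N by rewrite repr_pm1_small; lia.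
have hs : (0 < iter j (sigma p) i <= h)%N.
  have pi : ~~ (p %| i)%N by apply/negP => /dvdn_leq; lia.
  rewrite -(repr_id p_prime p_gt2 ih) iter_sigma_repr // repr_range //.
  by rewrite Euclid_dvdM // Euclid_dvdX // (negPf (alpha_ndvd p_prime)) (negPf pi).
rewrite ha // /exponents !hb // ?(leq_trans vu) //; lia.
Qed.

(** The coefficient of index [p s] is [p ^ (k - 1)] times the one of index [s], which
    is zero below the order of vanishing. *)
Theorem eta_quotient_eigenform (a : seq int) u v : (0 < v)%N -> (v <= u <= h)%N ->
  a`_0 = (if u == v then 6 else 4) ->
  (forall i, (0 < i <= h)%N -> a`_i = exponents p u v i) ->
  (forall tau : Cplx R, upper_half_plane tau ->
     Up p (feta p a) tau = p%:R ^+ eigen_exponent u v * feta p a tau) /\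
  (forall j s : nat, s%:R < ell p (sigma_pow p j a) ->
     qcoef (@feta R p (sigma_pow p j a)) (p * s) = 0).
Proof.
move=> v0 vuh a0 ha; split=> [tau tau_up|j s].
  have [c [hc hp _]] := feta_lambert R p_prime p_gt2 v0 vuh a0 ha.
  exact: (Up_eigen hc hp tau_up).
have [u' [v' [v'0 vuh' uv' hb]]] := sigma_pow_exponents j v0 vuh ha.
have b0 : (sigma_pow p j a)`_0 = (if u' == v' then 6 else 4).
  by rewrite nth0_sigma_pow a0 uv'.
rewrite (ell_exponents p_prime p_gt2 v'0 vuh' b0 hb) ltr_nat => sv.
have [c [hc hp small]] := feta_lambert R p_prime p_gt2 v'0 vuh' b0 hb.
by rewrite (qcoefE hc) hp small ?mulr0.
Qed.

End EigenForms.

Theorem theorem1p5 (R : realType) (p : nat) (p_prime : prime p) :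
  ((5 <= p)%N ->
     forall a : seq int,
     a = [:: 6; 1] ++ nseq (halfp p - 2) 0 ++ [:: -4] ->
     (forall tau : Cplx R, upper_half_plane tau ->
        Up p (feta p a) tau = p%:R ^+ 2 * feta p a tau)
     <->
     (forall j s : nat, (2 <= j <= halfp p)%N ->
        s%:R < ell p (sigma_pow p j a) ->
        qcoef (@feta R p (sigma_pow p j a)) (p * s) = 0))
  /\
  ((11 <= p)%N ->
     forall a : seq int,
     [\/ a = [:: 4; -2] ++ nseq (halfp p - 4) 0 ++ [:: 1; -2; 1],
         a = [:: 4; -2] ++ nseq (halfp p - 3) 0 ++ [:: 1; -1]
       | a = [:: 4; 1; 1] ++ nseq (halfp p - 4) 0 ++ [:: -2; -2]] ->
     (forall tau : Cplx R, upper_half_plane tau ->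
        Up p (feta p a) tau = p%:R * feta p a tau)
     <->
     (forall j s : nat, (2 <= j <= halfp p)%N ->
        s%:R < ell p (sigma_pow p j a) ->
        qcoef (@feta R p (sigma_pow p j a)) (p * s) = 0)).
Proof.
have both_true (w : nat) (a : seq int) u v : (2 < p)%N -> (0 < v)%N -> (v <= u <= halfp p)%N ->
    eigen_exponent u v = w -> a`_0 = (if u == v then 6 else 4) ->
    (forall i, (0 < i <= halfp p)%N -> a`_i = exponents p u v i) ->
    (forall tau : Cplx R, upper_half_plane tau ->
        Up p (feta p a) tau = p%:R ^+ w * feta p a tau) <->
    (forall j s : nat, (2 <= j <= halfp p)%N -> s%:R < ell p (sigma_pow p j a) ->
        qcoef (@feta R p (sigma_pow p j a)) (p * s) = 0).
  move=> p_gt2 v0 vuh <- a0 ha.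
  have [h1 h2] := eta_quotient_eigenform R p_prime p_gt2 v0 vuh a0 ha.
  by split=> _ // j s _; exact: h2.
split=> [p5 a ->|p11 a ha].
  have p_gt2 : (2 < p)%N by lia.
  have p2 := double_halfp p_prime p_gt2.
  (* (p - 1) / 2 + (p - 1) / 2 is the opposite of 1 modulo p *)
  apply: (both_true 2 _ (halfp p) (halfp p)) => //; rewrite ?leqnn ?andbT //; first by lia.
  - by rewrite /eigen_exponent eqxx.
  - by rewrite eqxx.
  have r : repr_pm1 p (halfp p + halfp p) = 1%N by rewrite repr_pm1_small; lia.
  rewrite /exponents r subnn => -[|[|i]] // /andP[_ ih] /=.
    by lia.
  rewrite nth_cat nth_nseq size_nseq if_same; case: ltnP => hi; first by lia.
  by case E: (i - (halfp p - 2))%N => [|k] /=; lia.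
have p_gt2 : (2 < p)%N by lia.
have p2 := double_halfp p_prime p_gt2.
(* [u] and [v] index the squared theta products of the denominator; for the second
   vector, [u + v] is [u] up to sign modulo [p], whence the entry [-1] *)
rewrite -[p%:R]expr1; case: ha => ->.
- have uv : (halfp p).-1 != 1%N by lia.
  apply: (both_true 1%N _ (halfp p).-1 1%N) => //; [lia|..].
  + by rewrite /eigen_exponent (negPf uv).
  + by rewrite (negPf uv).
  have r : repr_pm1 p ((halfp p).-1 + 1) = halfp p by rewrite repr_pm1_small; lia.
  rewrite /exponents r => -[|[|i]] // /andP[_ ih] /=; first by lia.
  rewrite nth_cat nth_nseq size_nseq if_same; case: ltnP => hi; first by lia.
  by case E: (i - (halfp p - 4))%N => [|[|[|k]]] /=; lia.
- have uv : halfp p != 1%N by lia.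
  apply: (both_true 1%N _ (halfp p) 1%N) => //; [lia|..].
  + by rewrite /eigen_exponent (negPf uv).
  + by rewrite (negPf uv).
  have r : repr_pm1 p (halfp p + 1) = halfp p by rewrite repr_pm1_small; lia.
  rewrite /exponents r => -[|[|i]] // /andP[_ ih] /=; first by lia.
  rewrite nth_cat nth_nseq size_nseq if_same; case: ltnP => hi; first by lia.
  by case E: (i - (halfp p - 3))%N => [|[|k]] /=; lia.
have uv : halfp p != (halfp p).-1 by lia.
apply: (both_true 1%N _ (halfp p) (halfp p).-1) => //; [lia|lia|..].
- by rewrite /eigen_exponent (negPf uv).
- by rewrite (negPf uv).
have r : repr_pm1 p (halfp p + (halfp p).-1) = 2%N by rewrite repr_pm1_small; lia.
rewrite /exponents r => -[|[|[|i]]] // /andP[_ ih] /=; [lia|lia|].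
rewrite nth_cat nth_nseq size_nseq if_same; case: ltnP => hi; first by lia.
by case E: (i - (halfp p - 4))%N => [|[|k]] /=; lia.
Qed.
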